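(* Let $d\ge1$, $0<\sigma<\frac2d$ and $\lambda>0$. Then every normalized wave $e^{itc(\lambda)}\mathbf u_\lambda$, with $\mathbf u=\mathbf u_\lambda$, satisfies $\mathbf u\perp \mathrm{Ker}(\mathcal L_+)$; as such, the element $\mathcal L_+^{-1}\mathbf u$ is uniquely defined in $\mathrm{Ker}(\mathcal L_+)^\perp$. In addition, $\langle\mathcal L_+^{-1}\mathbf u,\mathbf u\rangle\le0$. If moreover the non-degeneracy condition $\langle\mathcal L_+^{-1}\mathbf u,\mathbf u\rangle\ne0$ holds, then $\langle\mathcal L_+^{-1}\mathbf u,\mathbf u\rangle<0$, and hence $e^{itc(\lambda)}\mathbf u_\lambda$ is spectrally stable.
   Context: The discrete Laplacian on $\mathbb Z^d$ is $(\Delta_{disc}\mathbf u)_n=\sum_{j\in\mathbb Z^d:|j-n|=1}u_j-2d\,u_n$. The focusing DNLS equation is $i\partial_tu_n+(\Delta_{disc}u)_n+|u_n|^{2\sigma}u_n=0$, $n\in\mathbb Z^d$. For $\mathbf u\in l^2(\mathbb Z^d)$ let $$H[\mathbf u]=\sum_{|j-n|=1}|u_j-u_n|^2-\frac1{\sigma+1}\sum_{n\in\mathbb Z^d}|u_n|^{2\sigma+2},$$ the first sum running over unordered nearest-neighbour pairs (so it equals $\langle-\Delta_{disc}\mathbf u,\mathbf u\rangle$). For $\lambda>0$, a normalized wave is $e^{itc(\lambda)}\mathbf u_\lambda$, where $\mathbf u_\lambda$ is a minimizer, with non-negative entries, of $H$ subject to $\|\mathbf u\|_{l^2}^2=\lambda$,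 and $c(\lambda)>0$ is the Lagrange multiplier for which $$-(\Delta_{disc}\mathbf u)_n+c(\lambda)u_n-u_n^{2\sigma+1}=0,\quad n\in\mathbb Z^d.$$ The linearized operators on $l^2(\mathbb Z^d)$ are $$\mathcal L_+=-\Delta_{disc}+c(\lambda)-(2\sigma+1)u_n^{2\sigma},\qquad \mathcal L_-=-\Delta_{disc}+c(\lambda)-u_n^{2\sigma}.$$ $\mathcal L_+^{-1}\mathbf u$ denotes the element $g\in\mathrm{Ker}(\mathcal L_+)^\perp$ with $\mathcal L_+g=\mathbf u$. The wave is spectrally stable if the eigenvalue problem $$\begin{pmatrix}0&-1\\1&0\end{pmatrix}\begin{pmatrix}\mathcal L_+&0\\0&\mathcal L_-\end{pmatrix}\mathbf v=\mu\,\mathbf v$$ has no non-trivial solution $(\mu,\mathbf v)$ with $\Re\mu>0$ and $\mathbf v\in l^2(\mathbb Z^d)\times l^2(\mathbb Z^d)$ (complex-valued). *)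

(* Defs.v *)
From HB Require Import structures.
From mathcomp Require Import all_boot all_order all_algebra.
From mathcomp Require Import finmap complex.
From mathcomp Require Import all_classical all_reals all_analysis.

Set Implicit Arguments.
Unset Strict Implicit.
Unset Printing Implicit Defensive.

Import Order.TTheory GRing.Theory Num.Theory.
Import ComplexField.

Local Open Scope classical_set_scope.
Local Open Scope ring_scope.
Local Open Scope complex_scope.

Notation lattice d := 'rV[int]_d.

(* Euclidean distance 1; squared, so that it is a statement about integers. *)
Definition neighbors d (n : lattice d) : set (lattice d) :=
  [set j | \sum_(k < d) (j ord0 k - n ord0 k) ^+ 2 = 1].

(* Used with V = R for the wave profile and V = R[i] for general sequences. *)
Definition disc_laplacian d (V : zmodType) (u : lattice d -> V) :
    lattice d -> V :=
  fun n => \sum_(j \in neighbors n) u j - u n *+ (2 * d).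

Section Sequences.
Variables (R : realType) (d : nat).
Implicit Types (u v f g : lattice d -> R[i]).

Definition sqnorm u : \bar R :=
  \esum_(n in setT) ((Normc.normc (u n)) ^+ 2)%:E.

Definition in_l2 u : Prop := (sqnorm u < +oo)%E.

(* Sum of an absolutely summable real family. As [esum] is meant for
   nonnegative families, the positive and negative parts are summed apart. *)
Definition rsum (a : lattice d -> R) : R :=
  let b n := (a n)%:E in
  fine (esum setT (b^\+)%E) - fine (esum setT (b^\-)%E).

Definition csum f : R[i] :=
  rsum (fun n => complex.Re (f n)) +i* rsum (fun n => complex.Im (f n)).

(* Complex-valued; in the order of R[i], [inner f g <= 0] (or [< 0]) means that
   the product is real and nonpositive (or negative). *)
Definition inner f g : R[i] := csum (fun n => f n * (g n)^*%C).

Definition orthogonal_compl (K : set (lattice d -> R[i])) :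
    set (lattice d -> R[i]) :=
  [set f | in_l2 f /\ forall k, K k -> inner f k = 0].

Definition complexify (u : lattice d -> R) : lattice d -> R[i] :=
  fun n => (u n)%:C.

(* Both series converge for u in l^2, so [fine] never meets an infinite value
   there. The first one runs over ordered pairs (j, n) with |j - n| = 1, hence
   counts each unordered pair twice. *)
Definition hamiltonian (sigma : R) u : R :=
  2^-1 * fine (\esum_(p in [set p : lattice d * lattice d | neighbors p.2 p.1])
                 ((Normc.normc (u p.1 - u p.2)) ^+ 2)%:E)
  - (sigma + 1)^-1 *
    fine (\esum_(n in setT) (Normc.normc (u n) `^ (2 * sigma + 2))%:E).

(* e^{itc} u is a normalized wave: [u] has nonnegative (real) entries and
   minimizes the energy among all complex sequences of the same mass. *)
Definition normalized_wave (sigma lambda c : R) (u : lattice d -> R) : Prop :=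
  [/\ forall n, 0 <= u n,
      sqnorm (complexify u) = lambda%:E,
      forall w, sqnorm w = lambda%:E ->
        hamiltonian sigma (complexify u) <= hamiltonian sigma w,
      0 < c
    & forall n,
        - disc_laplacian u n + c * u n - u n `^ (2 * sigma + 1) = 0].

Section Linearization.
Variables (sigma c : R) (u : lattice d -> R).

Definition Lplus v : lattice d -> R[i] := fun n =>
  - disc_laplacian v n + c%:C * v n
  - ((2 * sigma + 1) * u n `^ (2 * sigma))%:C * v n.

Definition Lminus v : lattice d -> R[i] := fun n =>
  - disc_laplacian v n + c%:C * v n - (u n `^ (2 * sigma))%:C * v n.

Definition ker_Lplus : set (lattice d -> R[i]) :=
  [set v | in_l2 v /\ Lplus v = 0].

(* g is L_+^{-1} f *)
Definition is_Lplus_inv f g : Prop :=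
  orthogonal_compl ker_Lplus g /\ Lplus g = f.

Definition linearized_op (v : (lattice d -> R[i]) * (lattice d -> R[i])) :
    (lattice d -> R[i]) * (lattice d -> R[i]) :=
  (- Lminus v.2, Lplus v.1).

Definition spectrally_stable : Prop :=
  ~ exists (mu : R[i]) (v : (lattice d -> R[i]) * (lattice d -> R[i])),
    [/\ 0 < complex.Re mu, in_l2 v.1 /\ in_l2 v.2, v <> 0
      & linearized_op v = ((fun n => mu * v.1 n), (fun n => mu * v.2 n))].

End Linearization.
End Sequences.

Lemma neighborsE d (n : lattice d) :
  neighbors n = [set n + delta_mx ord0 k | k in [set: 'I_d]] `|`
                [set n - delta_mx ord0 k | k in [set: 'I_d]].
Proof.
apply/seteqP; split => j; rewrite /neighbors /=.
- move=> h.
  have [k hk] : exists k, j ord0 k - n ord0 k != 0.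
    apply/existsP; apply: contraT; rewrite negb_exists => /forallP h0.
    move: h; rewrite big1 // => i _.
    by move: (h0 i); rewrite negbK => /eqP ->; rewrite expr0n.
  move: h; rewrite (bigD1 k) //=; set S := (X in _ + X) => h.
  have S0 : 0 <= S by apply: sumr_ge0 => i _; rewrite sqr_ge0.
  have k1 : 1 <= (j ord0 k - n ord0 k) ^+ 2.
    by rewrite -gtz0_ge1 lt_neqAle sqr_ge0 andbT eq_sym sqrf_eq0.
  have S00 : S = 0.
    by apply/eqP; rewrite eq_le S0 andbT -(lerD2l 1) addr0 -[leRHS]h lerD2r.
  have jn i : i != k -> j ord0 i = n ord0 i.
    move=> ik; apply/eqP; rewrite -subr_eq0 -sqrf_eq0.
    by move/psumr_eq0P: S00 => -> // l _; rewrite sqr_ge0.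
  move: h; rewrite S00 addr0 => /eqP; rewrite sqrf_eq1 => /orP[] /eqP e.
  + left; exists k => //; apply/rowP => i.
    rewrite !mxE eqxx /=; have [->|/jn ->] := eqVneq i k; last by rewrite addr0.
    by rewrite -e addrC subrK.
  + right; exists k => //; apply/rowP => i.
    rewrite !mxE eqxx /=; have [->|/jn ->] := eqVneq i k; last by rewrite subr0.
    by rewrite -e addrC subrK.
- case=> -[k _ <-]; rewrite (bigD1 k) //= big1 => [|i /negPf ik].
  + by rewrite !mxE !eqxx addr0 addrAC subrr add0r expr1n.
  + by rewrite !mxE ik andbF addr0 subrr expr0n.
  + by rewrite !mxE !eqxx addr0 addrAC subrr add0r sqrrN expr1n.
  + by rewrite !mxE ik andbF subr0 subrr expr0n.
Qed.

Lemma disc_laplacianE d (V : zmodType) (u : lattice d -> V) n :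
  disc_laplacian u n =
  \sum_(k < d) (u (n + delta_mx ord0 k) + u (n - delta_mx ord0 k))
  - u n *+ (2 * d).
Proof.
congr (_ - _); rewrite neighborsE.
have delta_inj : injective (delta_mx ord0 : 'I_d -> lattice d).
  move=> k l /rowP/(_ k); rewrite !mxE !eqxx /=.
  by case: eqVneq => [->|].
rewrite fsbigU0; first last.
- move=> j [[k _ <-] [l _ /addrI/rowP/(_ k)]]; rewrite !mxE !eqxx /=.
  by case: (k == l).
- by apply: finite_image; exact: finite_finset.
- by apply: finite_image; exact: finite_finset.
have sumE (F : 'I_d -> V) : \sum_(k < d) F k = \sum_(k \in [set: 'I_d]) F k.
  rewrite fsbig_seq ?index_enum_uniq //; congr (bigop _ _ _).
  by congr finite_support; apply/seteqP; split => k //= _; rewrite mem_index_enum.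
rewrite big_split /= !sumE; congr (_ + _).
- apply: (reindex_fsbig (fun k => n + delta_mx ord0 k)); apply: inj_bij.
  by move=> k l _ _ /addrI; exact: delta_inj.
- apply: (reindex_fsbig (fun k => n - delta_mx ord0 k)); apply: inj_bij.
  by move=> k l _ _ /addrI/oppr_inj; exact: delta_inj.
Qed.

(* Main.v *)
Require Import Defs.
From HB Require Import structures.
From mathcomp Require Import all_boot all_order all_algebra.
From mathcomp Require Import finmap complex.
From mathcomp Require Import all_classical all_reals all_analysis.
From mathcomp Require Import ring lra.

(** The linearized operators have real coefficients, so a complex sequence is
    treated through its real and imaginary parts, and the analysis takes place
    in the real space of square summable sequences with the pairing [dot].

    The minimizer enters through its second variation. For [x] orthogonal to
    [u] and any [y], the sequence u + t (x + i y), rescaled to mass [lambda],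
    is an admissible competitor; expanding its energy to order t^2
    ([second_variation]) shows that L_+ is nonnegative on the orthogonal
    complement of [u] ([lplus_ge0]) and that L_- is nonnegative
    ([lminus_ge0]). Moreover L_- u = 0 is the equation of the wave, and
    L_+ u = - 2 sigma u^(2 sigma + 1), so that <L_+ u, u> < 0.

    These signs give the orthogonality to the kernel and the sign of the slope
    in the same way. If L_+ k = 0 with <u, k> <> 0, a combination
    v = u - a k is orthogonal to [u] and <L_+ v, v> = <L_+ u, u> < 0. If
    L_+ g = u with <g, u> > 0, then v = u - a g with a = lambda / <g, u> is
    orthogonal to [u] and <L_+ v, v> = <L_+ u, u> - a lambda < 0. Both
    contradict [lplus_ge0] ([ker_lplus_orth], [lplus_inv_le0]).

    That L_+ g = u can be solved is a Fredholm alternative. The potential of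
    L_+ tends to 0 at infinity, hence exceeds c / 2 at finitely many sites
    only. Without these sites the operator is coercive, and a monotone Jacobi
    iteration inverts it ([lop_surj]). The sites are then restored one at a
    time; each is a rank one perturbation, under which the property
    range + kernel = whole space is preserved ([fredholm_site]). Applying the
    decomposition twice gives a solution orthogonal to the kernel
    ([lop_solve]).

    For stability, let - L_- v2 = mu v1 and L_+ v1 = mu v2 with Re mu > 0.
    Since L_- u = 0, the component v1 is orthogonal to [u], so
    <L_+ v1, v1> and <L_- v2, v2> are both nonnegative reals; they equal
    mu z and - mu z^* for the same number z = <v2, v1>, and Re mu > 0 forces
    z = 0. Then <L_- v2, v2> = 0, hence L_- v2 = 0 because L_- is nonnegative,
    and v1 = 0, v2 = 0 follow ([no_growing_mode]). *)

Set Implicit Arguments.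
Unset Strict Implicit.
Unset Printing Implicit Defensive.

Import Order.TTheory GRing.Theory Num.Theory.
Import numFieldNormedType.Exports.
Local Open Scope classical_set_scope.
Local Open Scope ring_scope.
Local Open Scope complex_scope.


(** * Absolutely summable families over the lattice *)

Section Sums.
Variables (R : realType) (d : nat).
Implicit Types (a b : lattice d -> R).

Definition asum a : Prop := (\esum_(n in setT) `|a n|%:E < +oo)%E.

Lemma asum_le a b : asum b -> (forall n, `|a n| <= `|b n|) -> asum a.
Proof.
move=> sb ab; apply: le_lt_trans sb; apply: le_esum => n _.
by rewrite lee_fin.
Qed.

Lemma asumD a b : asum a -> asum b -> asum (fun n => a n + b n).
Proof.
move=> sa sb; apply: le_lt_trans (lte_add_pinfty sa sb).
rewrite -esumD//; apply: le_esum => n _.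
by rewrite lee_fin ler_normD.
Qed.

Lemma asumN a : asum a -> asum (fun n => - a n).
Proof. by move=> sa; apply: asum_le sa _ => n; rewrite normrN. Qed.

Lemma asum_fin_bound a C : (forall n, 0 <= a n) ->
  (forall F : {fset lattice d}, \sum_(n <- F) a n <= C) ->
  (\esum_(n in setT) (a n)%:E <= C%:E)%E.
Proof.
move=> a0 aC; apply: ge_ereal_sup => _ [X [finX _] <-].
by rewrite fsbig_finite//= sumEFin lee_fin.
Qed.

Lemma esum_asum a : (forall n, 0 <= a n) ->
  (\esum_(n in setT) (a n)%:E < +oo)%E -> asum a.
Proof.
move=> a0; apply: le_lt_trans; apply: le_esum => n _.
by rewrite ger0_norm.
Qed.

Lemma asum_esum a : (forall n, 0 <= a n) -> asum a ->
  (\esum_(n in setT) (a n)%:E < +oo)%E.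
Proof.
move=> a0; apply: le_lt_trans; apply: le_esum => n _.
by rewrite ger0_norm.
Qed.

Lemma asum_fin_num a : (forall n, 0 <= a n) -> asum a ->
  (\esum_(n in setT) (a n)%:E \is a fin_num)%E.
Proof.
move=> a0 sa; rewrite ge0_fin_numE ?asum_esum//.
by apply: esum_ge0 => n _; rewrite lee_fin.
Qed.

Lemma rsum_ge0E a : (forall n, 0 <= a n) ->
  rsum a = fine (\esum_(n in setT) (a n)%:E).
Proof.
move=> a0; rewrite /rsum.
rewrite (_ : esum _ _ = \esum_(n in setT) (a n)%:E); last first.
  apply: eq_esum => n _; rewrite funeposE.
  by apply/max_idPl; rewrite lee_fin.
rewrite (_ : esum _ (_^\-)%E = 0%E) ?subr0//.
apply: esum1 => n _; rewrite funenegE.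
by apply/max_idPr; rewrite leeNl oppe0 lee_fin.
Qed.

Lemma esum_rsum a : (forall n, 0 <= a n) -> asum a ->
  (\esum_(n in setT) (a n)%:E)%E = (rsum a)%:E.
Proof. by move=> a0 sa; rewrite rsum_ge0E// fineK// asum_fin_num. Qed.

(** Any splitting of a family into nonnegative summable parts computes its
    sum, not only the one into positive and negative parts; linearity of
    [rsum] reduces to this. *)
Lemma rsum_sub a b : (forall n, 0 <= a n) -> (forall n, 0 <= b n) ->
  asum a -> asum b -> rsum (fun n => a n - b n) = rsum a - rsum b.
Proof.
move=> a0 b0 sa sb; rewrite (rsum_ge0E a0) (rsum_ge0E b0).
have sa' : summable setT (fun n => (a n)%:E) by [].
have sb' : summable setT (fun n => (b n)%:E) by [].
have := esumB sa' sb'.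
move=> /(_ (fun n _ => a0 n)) /(_ (fun n _ => b0 n)) h.
have sab : summable setT ((fun n => (a n)%:E) \- (fun n => (b n)%:E))%E.
  exact: summableB.
have fp : ((\esum_(n in [set: lattice d])
    (((fun n => (a n)%:E) \- (fun n => (b n)%:E))^\+ n)) \is a fin_num)%E.
  rewrite ge0_fin_numE; last by apply: esum_ge0.
  have := summable_funepos sab; apply: le_lt_trans; apply: le_esum => n _.
  by rewrite gee0_abs.
have fn : ((\esum_(n in [set: lattice d])
    (((fun n => (a n)%:E) \- (fun n => (b n)%:E))^\- n)) \is a fin_num)%E.
  rewrite ge0_fin_numE; last by apply: esum_ge0.
  have := summable_funeneg sab; apply: le_lt_trans; apply: le_esum => n _.
  by rewrite gee0_abs.
rewrite /rsum -fineB//= -fineB ?asum_fin_num//=.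
by congr fine.
Qed.

(** With [rsum_sub], reduces statements about signed families to nonnegative
    ones. *)
Lemma asum_posneg a : asum a -> exists p q,
  [/\ forall n, 0 <= p n, forall n, 0 <= q n, asum p, asum q
    & a = fun n => p n - q n].
Proof.
move=> sa; exists (fun n => Num.max (a n) 0), (fun n => Num.max (- a n) 0); split.
- by move=> n; rewrite le_max lexx orbT.
- by move=> n; rewrite le_max lexx orbT.
- by apply: asum_le sa _ => n; case: (leP (a n) 0); rewrite ?normr0.
- by apply: asum_le sa _ => n; case: (leP (- a n) 0); rewrite ?normr0 ?normrN.
- by apply/funext => n; case: (leP (a n) 0); case: (leP (- a n) 0); lra.
Qed.

Lemma rsumD_ge0 a b : (forall n, 0 <= a n) -> (forall n, 0 <= b n) ->
  asum a -> asum b -> rsum (fun n => a n + b n) = rsum a + rsum b.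
Proof.
move=> a0 b0 sa sb; rewrite !rsum_ge0E//; last by move=> n; exact: addr_ge0.
rewrite -fineD ?asum_fin_num//; congr fine.
rewrite -esumD => [||n _]; rewrite ?lee_fin//.
by move=> n _; rewrite lee_fin.
Qed.

Lemma rsumB a b : asum a -> asum b ->
  rsum (fun n => a n - b n) = rsum a - rsum b.
Proof.
move=> /asum_posneg[p [q [p0 q0 sp sq ->]]] /asum_posneg[r [s [r0 s0 sr ss ->]]].
rewrite (_ : (fun n => _) = (fun n => (p n + s n) - (q n + r n))); last first.
  by apply/funext => n; ring.
have ps0 n : 0 <= p n + s n by apply: addr_ge0.
have qr0 n : 0 <= q n + r n by apply: addr_ge0.
rewrite (rsum_sub ps0 qr0 (asumD sp ss) (asumD sq sr)).
by rewrite (rsum_sub p0 q0)// (rsum_sub r0 s0)// !rsumD_ge0//; ring.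
Qed.

Lemma rsum0 : rsum (fun _ : lattice d => 0 : R) = 0.
Proof. by rewrite rsum_ge0E// esum1. Qed.

Lemma asum0 : asum (fun _ : lattice d => 0 : R).
Proof. by rewrite /asum esum1// => n _; rewrite normr0. Qed.

Lemma rsumN a : asum a -> rsum (fun n => - a n) = - rsum a.
Proof.
move=> sa; rewrite -[RHS]add0r -[in RHS]rsum0 -(rsumB asum0 sa).
by congr rsum; apply/funext => n; rewrite add0r.
Qed.

Lemma rsumD a b : asum a -> asum b ->
  rsum (fun n => a n + b n) = rsum a + rsum b.
Proof.
move=> sa sb; rewrite -[rsum b]opprK -rsumN// -(rsumB sa (asumN sb)).
by congr rsum; apply/funext => n; rewrite opprK.
Qed.

Lemma rsum_ge0 a : (forall n, 0 <= a n) -> 0 <= rsum a.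
Proof.
move=> a0; rewrite rsum_ge0E//; apply: fine_ge0; apply: esum_ge0 => n _.
by rewrite lee_fin.
Qed.

Lemma le_rsum a b : asum a -> asum b -> (forall n, a n <= b n) ->
  rsum a <= rsum b.
Proof.
move=> sa sb ab; rewrite -subr_ge0 -rsumB//; apply: rsum_ge0 => n.
by rewrite subr_ge0.
Qed.

Lemma fin_le_rsum a (F : {fset lattice d}) : (forall n, 0 <= a n) -> asum a ->
  \sum_(n <- F) a n <= rsum a.
Proof.
move=> a0 sa; rewrite rsum_ge0E// -lee_fin fineK ?asum_fin_num// -sumEFin.
rewrite esum_ge//; exists [set` F]; first by split.
by rewrite fsbig_finite//= set_fsetK.
Qed.

(** Bounding finite partial sums bounds the whole sum; this plays the role
    of the Fatou lemma below. *)
Lemma fin_bound_asum a C : (forall n, 0 <= a n) ->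
  (forall F : {fset lattice d}, \sum_(n <- F) a n <= C) ->
  asum a /\ rsum a <= C.
Proof.
move=> a0 aC; have h := asum_fin_bound a0 aC.
have sa : asum a by apply: esum_asum => //; apply: le_lt_trans h _; rewrite ltry.
by split => //; rewrite rsum_ge0E// -lee_fin fineK// asum_fin_num.
Qed.

Lemma asumZ (r : R) a : asum a -> asum (fun n => r * a n).
Proof.
move=> sa; have san : asum (fun n => `|a n|).
  by apply: asum_le sa _ => n; rewrite normr_id.
apply: (@asum_le _ (fun n => `|r| * `|a n|)); last first.
  by move=> n; rewrite -normrM normr_id.
apply: (@fin_bound_asum _ (`|r| * rsum (fun n => `|a n|)) _ _).1 => [n|F].
  exact: mulr_ge0.
by rewrite -mulr_sumr ler_wpM2l// fin_le_rsum.
Qed.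

Lemma rsumZ_ge0 (r : R) a : 0 <= r -> (forall n, 0 <= a n) -> asum a ->
  rsum (fun n => r * a n) = r * rsum a.
Proof.
have half (s : R) b : 0 <= s -> (forall n, 0 <= b n) -> asum b ->
    rsum (fun n => s * b n) <= s * rsum b.
  move=> s0 b0 sb; apply: (@fin_bound_asum _ _ _ _).2 => [n|F].
    exact: mulr_ge0.
  by rewrite -mulr_sumr ler_wpM2l// fin_le_rsum.
rewrite le_eqVlt => /predU1P[<- a0 sa|r0 a0 sa].
  by rewrite mul0r -[RHS]rsum0; congr rsum; apply/funext => n; rewrite mul0r.
apply/eqP; rewrite eq_le; apply/andP; split; first by rewrite half// ltW.
rewrite -ler_pdivlMl//.
rewrite [X in rsum X <= _](_ : a = (fun n => r^-1 * (r * a n))); last first.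
  by apply/funext => n; rewrite mulKf// gt_eqF.
apply: half; [by rewrite invr_ge0 ltW| |exact: asumZ].
by move=> n; rewrite mulr_ge0// ltW.
Qed.

Lemma rsumZ (r : R) a : asum a -> rsum (fun n => r * a n) = r * rsum a.
Proof.
have pos (s : R) b : 0 <= s -> asum b -> rsum (fun n => s * b n) = s * rsum b.
  move=> s0 /asum_posneg[p [q [p0 q0 sp sq ->]]].
  rewrite rsum_sub// mulrBr -!rsumZ_ge0// -rsumB; [|exact: asumZ..].
  by congr rsum; apply/funext => n; rewrite mulrBr.
move=> sa; have [r0|r0] := leP 0 r; first exact: pos.
rewrite (_ : (fun n => _) = fun n => - (- r * a n)); last first.
  by apply/funext => n; rewrite mulNr opprK.
by rewrite rsumN ?pos ?mulNr ?opprK ?oppr_ge0 ?(ltW r0)//; exact: asumZ.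
Qed.

Lemma shift_bij (e : lattice d) : set_bij setT setT (fun n => n + e).
Proof.
split => //; first by move=> m n _ _ /addIr.
by move=> n _; exists (n - e) => //; rewrite subrK.
Qed.

Lemma asum_shift a e : asum a -> asum (fun n => a (n + e)).
Proof. by rewrite /asum (reindex_esum _ _ _ _ (shift_bij e)). Qed.

Lemma rsum_shift a e : rsum (fun n => a (n + e)) = rsum a.
Proof.
rewrite /rsum; congr (fine _ - fine _).
  rewrite [RHS](reindex_esum _ _ _ _ (shift_bij e)).
  by apply: eq_esum => n _; rewrite !funeposE.
rewrite [RHS](reindex_esum _ _ _ _ (shift_bij e)).
by apply: eq_esum => n _; rewrite !funenegE.
Qed.

(** A finite set that captures the sum up to [eps] leaves room for no further
    term larger than [eps]. *)
Lemma asum_small a (eps : R) : 0 < eps -> (forall n, 0 <= a n) -> asum a ->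
  exists F : {fset lattice d}, forall n, n \notin F -> a n <= eps.
Proof.
move=> e0 a0 sa.
have [F hF] : exists F : {fset lattice d}, rsum a - eps < \sum_(n <- F) a n.
  apply: contrapT => /forallNP h.
  have : rsum a <= rsum a - eps.
    apply: (@fin_bound_asum _ _ a0 _).2 => F; rewrite leNgt; apply/negP; exact: h.
  lra.
exists F => n nF; have := fin_le_rsum (n |` F)%fset a0 sa.
rewrite big_fsetU1//=; lra.
Qed.

Lemma rsum_sum I (s : seq I) (F : I -> lattice d -> R) :
  (forall i, asum (F i)) -> asum (fun n => \sum_(i <- s) F i n) /\
  rsum (fun n => \sum_(i <- s) F i n) = \sum_(i <- s) rsum (F i).
Proof.
move=> sF; elim: s => [|i s [IH1 IH2]].
  rewrite big_nil (_ : (fun n => _) = fun=> 0); last first.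
    by apply/funext => n; rewrite big_nil.
  by split; [exact: asum0|exact: rsum0].
rewrite (_ : (fun n => _) = fun n => F i n + \sum_(i <- s) F i n); last first.
  by apply/funext => n; rewrite big_cons.
by split; [exact: asumD|rewrite rsumD// IH2 big_cons].
Qed.

End Sums.

(** * Square summable sequences and discrete Schroedinger operators *)

Section SquareSummable.
Variables (R : realType) (d : nat).
Implicit Types (x y z q : lattice d -> R).

Definition l2 x : Prop := asum (fun n => x n ^+ 2).

Definition dot x y : R := rsum (fun n => x n * y n).

(** A single operation for linear combinations, so that bilinearity of [dot]
    and linearity of the operators are one rewriting rule each. *)
Definition lc (a : R) x (b : R) y : lattice d -> R := fun n => a * x n + b * y n.

Definition bounded_seq q : Prop := exists C, forall n, `|q n| <= C.

Lemma asum_mul x y : l2 x -> l2 y -> asum (fun n => x n * y n).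
Proof.
move=> lx ly; apply: asum_le (asumD lx ly) _ => n.
rewrite [leRHS]ger0_norm ?addr_ge0 ?sqr_ge0//.
by rewrite ler_norml; apply/andP; split; nra.
Qed.

Lemma l2_le x y : l2 y -> (forall n, `|x n| <= `|y n|) -> l2 x.
Proof.
move=> ly xy; apply: asum_le ly _ => n.
by rewrite !normrX lerXn2r ?nnegrE.
Qed.

Lemma l2Z (a : R) x : l2 x -> l2 (fun n => a * x n).
Proof.
move=> lx; rewrite /l2; under eq_fun do rewrite exprMn.
exact: asumZ.
Qed.

Lemma l2D x y : l2 x -> l2 y -> l2 (fun n => x n + y n).
Proof.
move=> lx ly; apply: asum_le (asumD (asumZ 2 lx) (asumZ 2 ly)) _ => n.
rewrite ger0_norm ?sqr_ge0// ger0_norm.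
  by have := sqr_ge0 (x n - y n); nra.
by rewrite addr_ge0// mulr_ge0// sqr_ge0.
Qed.

Lemma l2_lc (a : R) x (b : R) y : l2 x -> l2 y -> l2 (lc a x b y).
Proof. by move=> lx ly; apply: l2D; exact: l2Z. Qed.

Lemma l2_0 : l2 (fun=> 0).
Proof. by rewrite /l2; under eq_fun do rewrite expr0n; exact: asum0. Qed.

Lemma l2_shift x e : l2 x -> l2 (fun n => x (n + e)).
Proof. exact: (@asum_shift R d (fun n => x n ^+ 2)). Qed.

Lemma l2_bounded_mul q x : bounded_seq q -> l2 x -> l2 (fun n => q n * x n).
Proof.
move=> [C qC] lx; apply: l2_le (l2Z C lx) _ => n.
by rewrite !normrM ler_wpM2r// (le_trans (qC n))// ler_norm.
Qed.

Lemma l2_bounded x : l2 x -> bounded_seq x.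
Proof.
move=> lx; exists (1 + rsum (fun n => x n ^+ 2)) => n.
have := fin_le_rsum [fset n]%fset (fun n => sqr_ge0 (x n)) lx.
rewrite big_seq_fset1 => h; rewrite -real_normK ?num_real// in h.
by move: h; have := normr_ge0 (x n); set t := `|x n|; nra.
Qed.

Lemma dotC x y : dot x y = dot y x.
Proof. by congr rsum; apply/funext => n; rewrite mulrC. Qed.

Lemma dot_lcl a x b y z : l2 x -> l2 y -> l2 z ->
  dot (lc a x b y) z = a * dot x z + b * dot y z.
Proof.
move=> lx ly lz; rewrite -!rsumZ; [|exact: asum_mul..].
rewrite -rsumD; [|by apply: asumZ; exact: asum_mul..].
by congr rsum; apply/funext => n; rewrite /lc; ring.
Qed.

Lemma dot_lcr a x b y z : l2 x -> l2 y -> l2 z ->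
  dot z (lc a x b y) = a * dot z x + b * dot z y.
Proof. by move=> lx ly lz; rewrite dotC dot_lcl// !(dotC z). Qed.

Lemma dot_ge0 x : 0 <= dot x x.
Proof. by apply: rsum_ge0 => n; rewrite -expr2 sqr_ge0. Qed.

Lemma dot0l x : dot (fun=> 0) x = 0.
Proof. by rewrite -[RHS](rsum0 R d); congr rsum; apply/funext => n; rewrite mul0r. Qed.

Lemma dot0r x : dot x (fun=> 0) = 0.
Proof. by rewrite dotC dot0l. Qed.

Lemma dot_eq0 x : l2 x -> dot x x = 0 -> x = fun=> 0.
Proof.
move=> lx x0; apply/funext => n.
have := fin_le_rsum [fset n]%fset (fun n => sqr_ge0 (x n)) lx.
rewrite big_seq_fset1 [leRHS](_ : _ = 0) => [h|]; last exact: x0.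
by apply/eqP; rewrite -sqrf_eq0 eq_le h sqr_ge0.
Qed.

Lemma dot_lc_diff x y : l2 x -> l2 y ->
  dot (lc 1 x (-1) y) (lc 1 x (-1) y) = dot x x - 2 * dot x y + dot y y.
Proof.
move=> lx ly; have lxy := l2_lc 1 (-1) lx ly.
by rewrite dot_lcl// !dot_lcr// (dotC y x); ring.
Qed.

Lemma dot_le_half x y : l2 x -> l2 y -> dot x y <= (dot x x + dot y y) / 2.
Proof.
move=> lx ly.
have := dot_ge0 (lc 1 x (-1) y).
rewrite dot_lc_diff//; lra.
Qed.

Lemma dot_shift x y e :
  dot (fun n => x (n + e)) y = dot x (fun n => y (n - e)).
Proof.
rewrite /dot -[RHS](rsum_shift _ e); congr rsum.
by apply/funext => n; rewrite addrK.
Qed.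

Lemma dot_shiftE x e : dot (fun n => x (n + e)) (fun n => x (n + e)) = dot x x.
Proof. exact: (@rsum_shift R d (fun n => x n * x n)). Qed.

(** The adjacency operator of the lattice. *)
Definition adj x : lattice d -> R := fun n =>
  \sum_(k < d) (x (n + delta_mx ord0 k) + x (n - delta_mx ord0 k)).

Lemma l2_sum I (s : seq I) (F : I -> lattice d -> R) :
  (forall i, l2 (F i)) -> l2 (fun n => \sum_(i <- s) F i n).
Proof.
move=> lF; elim: s => [|i s IH].
  by under eq_fun do rewrite big_nil; exact: l2_0.
by under eq_fun do rewrite big_cons; exact: l2D.
Qed.

Lemma l2_adj x : l2 x -> l2 (adj x).
Proof. by move=> lx; apply: l2_sum => k; apply: l2D; exact: l2_shift. Qed.

Lemma dot_adj x y : l2 x -> l2 y ->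
  dot (adj x) y = \sum_(k < d) (dot (fun n => x (n + delta_mx ord0 k)) y +
                               dot (fun n => x (n - delta_mx ord0 k)) y).
Proof.
move=> lx ly.
rewrite -(eq_bigr _ (fun k _ => rsumD (asum_mul (l2_shift (delta_mx ord0 k) lx) ly)
  (asum_mul (l2_shift (- delta_mx ord0 k) lx) ly))).
rewrite -(rsum_sum _ _).2 => [|k]; last first.
  by apply: asumD; apply: asum_mul => //; exact: l2_shift.
congr rsum; apply/funext => n; rewrite mulr_suml; apply: eq_bigr => k _.
by rewrite mulrDl.
Qed.

(** Moving a shift across [dot] inverts it, and [adj] sums over each shift
    and its inverse. *)
Lemma adj_sym x y : l2 x -> l2 y -> dot (adj x) y = dot x (adj y).
Proof.
move=> lx ly; rewrite dot_adj// [RHS]dotC dot_adj//; apply: eq_bigr => k _.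
rewrite addrC; congr (_ + _); rewrite [LHS]dot_shift [LHS]dotC//.
by under eq_fun do rewrite opprK.
Qed.

Lemma dot_adj_le x : l2 x -> dot (adj x) x <= (2 * d)%:R * dot x x.
Proof.
move=> lx; rewrite dot_adj//.
have -> : (2 * d)%:R * dot x x = \sum_(k < d) (dot x x + dot x x).
  by rewrite sumr_const card_ord -mulr2n -mulrnA mulr_natl.
apply: ler_sum => k _; apply: lerD.
all: apply: le_trans (dot_le_half (l2_shift _ lx) lx) _.
all: rewrite dot_shiftE; lra.
Qed.

Variable c : R.

(** The operator - Delta + c - q; both linearized operators have this form,
    as does - Delta (with c = 0, q = 0). *)
Definition lop q x : lattice d -> R :=
  fun n => - disc_laplacian x n + c * x n - q n * x n.

Lemma lopE q x n : lop q x n = ((2 * d)%:R + c - q n) * x n - adj x n.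
Proof. by rewrite /lop disc_laplacianE -mulr_natl /adj; ring. Qed.

Lemma lop_adj q x :
  lop q x = lc 1 (fun n => ((2 * d)%:R + c - q n) * x n) (-1) (adj x).
Proof. by apply/funext => n; rewrite lopE /lc; ring. Qed.

Lemma adj_lc a x b y : adj (lc a x b y) = lc a (adj x) b (adj y).
Proof.
apply/funext => n; rewrite /lc /adj !mulr_sumr -big_split /=.
by apply: eq_bigr => k _; ring.
Qed.

Lemma lop_lc q a x b y : lop q (lc a x b y) = lc a (lop q x) b (lop q y).
Proof. by apply/funext => n; rewrite /lc !lopE adj_lc /lc; ring. Qed.

Lemma bounded_seq_diag q : bounded_seq q ->
  bounded_seq (fun n => (2 * d)%:R + c - q n).
Proof.
move=> [C qC]; exists (`|(2 * d)%:R + c| + C) => n.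
by rewrite (le_trans (ler_normB _ _))// lerD2l.
Qed.

Lemma l2_lop q x : bounded_seq q -> l2 x -> l2 (lop q x).
Proof.
move=> bq lx; rewrite lop_adj; apply: l2_lc; last exact: l2_adj.
by apply: l2_bounded_mul => //; exact: bounded_seq_diag.
Qed.

Lemma lop_sym q x y : bounded_seq q -> l2 x -> l2 y ->
  dot (lop q x) y = dot x (lop q y).
Proof.
move=> bq lx ly; have bq' := bounded_seq_diag bq.
have lx' := l2_bounded_mul bq' lx; have ly' := l2_bounded_mul bq' ly.
have lax := l2_adj lx; have lay := l2_adj ly.
rewrite !lop_adj dot_lcl// dot_lcr// adj_sym//; congr (_ * _ + _).
by congr rsum; apply/funext => n; ring.
Qed.

Lemma lop_range_ker q x k : bounded_seq q -> l2 x -> l2 k ->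
  lop q k = (fun=> 0) -> dot (lop q x) k = 0.
Proof. by move=> bq lx lk Lk; rewrite lop_sym// Lk dot0r. Qed.

(** The discrete Laplacian is nonpositive, since each shift is an isometry;
    so the part c - q >= c / 2 of the diagonal survives. *)
Lemma lop_coercive q x : 0 < c -> bounded_seq q -> (forall n, q n <= c / 2) ->
  l2 x -> c / 2 * dot x x <= dot (lop q x) x.
Proof.
move=> c0 bq qc lx; have bq' := bounded_seq_diag bq.
have lx' := l2_bounded_mul bq' lx; have lax := l2_adj lx.
rewrite lop_adj dot_lcl//.
have : ((2 * d)%:R + c / 2) * dot x x <=
    dot (fun n => ((2 * d)%:R + c - q n) * x n) x.
  rewrite -rsumZ; last exact: asum_mul.
  apply: le_rsum; [by apply: asumZ; exact: asum_mul|exact: asum_mul|move=> n].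
  rewrite -mulrA; apply: ler_wpM2r; first by rewrite -expr2 sqr_ge0.
  by have := qc n; lra.
have := dot_adj_le lx; lra.
Qed.

End SquareSummable.

(** * Inversion of coercive operators by monotone iteration *)

Section Solve.
Variables (R : realType) (d : nat) (c : R).
Implicit Types (f g h k x y z q : lattice d -> R).
Hypothesis c0 : 0 < c.

Lemma cvg_finsum I (s : seq I) (u : I -> nat -> R) (l : I -> R) :
  (forall i, u i @ \oo --> l i) ->
  (fun m => \sum_(i <- s) u i m) @ \oo --> \sum_(i <- s) l i.
Proof.
move=> ul; elim: s => [|i s IH].
  rewrite big_nil (_ : (fun m => _) = fun=> 0); first exact: cvg_cst.
  by apply/funext => m; rewrite big_nil.
rewrite big_cons (_ : (fun m => _) = u i \+ (fun m => \sum_(i <- s) u i m)).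
  by apply: cvgD.
by apply/funext => m; rewrite big_cons.
Qed.

Lemma adj_ge0 x : (forall n, 0 <= x n) -> forall n, 0 <= adj x n.
Proof. by move=> x0 n; apply: sumr_ge0 => k _; exact: addr_ge0. Qed.

Lemma adj_le x y : (forall n, x n <= y n) -> forall n, adj x n <= adj y n.
Proof. by move=> xy n; apply: ler_sum => k _; exact: lerD. Qed.

Section Iteration.
Variables (q f : lattice d -> R).
Hypotheses (bq : bounded_seq q) (qc : forall n, q n <= c / 2).
Hypotheses (lf : l2 f) (f0 : forall n, 0 <= f n).

Let D n : R := (2 * d)%:R + c - q n.

Let D_ge n : c / 2 <= D n.
Proof. by have := qc n; have := ler0n R (2 * d); rewrite /D; lra. Qed.

Let D_gt0 n : 0 < D n.
Proof. by have := D_ge n; have := c0; lra. Qed.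

(** Jacobi iteration for (2 d + c - q) v = f + adj v, started at 0. *)
Fixpoint jacobi (i : nat) : lattice d -> R :=
  if i is j.+1 then fun n => (D n)^-1 * (f n + adj (jacobi j) n) else fun=> 0.

Let jacobi_ge0 i n : 0 <= jacobi i n.
Proof.
elim: i n => [//|i IH] n /=.
by rewrite mulr_ge0 ?invr_ge0 ?(ltW (D_gt0 n))// addr_ge0// adj_ge0.
Qed.

Let jacobi_nd i n : jacobi i n <= jacobi i.+1 n.
Proof.
elim: i n => [|i IH] n; first exact: (jacobi_ge0 1).
rewrite /= ler_wpM2l ?invr_ge0 ?(ltW (D_gt0 n))// lerD2l.
exact: adj_le.
Qed.

Let jacobi_l2 i : l2 (jacobi i).
Proof.
elim: i => [|i IH]; first exact: l2_0.
apply: l2_bounded_mul; last by apply: l2D => //; exact: l2_adj.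
exists (c / 2)^-1 => n; rewrite ger0_norm ?invr_ge0 ?(ltW (D_gt0 n))//.
by rewrite lef_pV2 ?posrE// divr_gt0.
Qed.

(** As the iterates increase, each is a subsolution; this turns coercivity
    into the uniform bound [jacobi_bound]. *)
Let jacobi_sub i n : lop c q (jacobi i) n <= f n.
Proof.
case: i => [|i]; rewrite lopE.
  rewrite [jacobi 0 n]/= mulr0 sub0r; apply: le_trans (f0 n).
  by rewrite oppr_le0; exact: adj_ge0.
rewrite lerBlDr [jacobi i.+1 n]/= mulVKf ?(gt_eqF (D_gt0 n))//.
by rewrite lerD2l; apply: adj_le => m; exact: jacobi_nd.
Qed.

(** Coercivity gives c / 2 <v, v> <= <f, v>, and <f, v> is absorbed by
    expanding the square of f - (c / 2) v. *)
Let jacobi_bound i : dot (jacobi i) (jacobi i) <= 4 / c ^+ 2 * dot f f.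
Proof.
have lv := jacobi_l2 i; set v := jacobi i in lv *.
have h1 := lop_coercive c0 bq qc lv.
have h2 : dot (lop c q v) v <= dot f v.
  apply: le_rsum; [by apply: asum_mul => //; exact: l2_lop|exact: asum_mul|].
  by move=> n; rewrite ler_wpM2r ?jacobi_sub ?jacobi_ge0.
have h3 := dot_ge0 (lc 1 f (- (c / 2)) v).
rewrite dot_lcl ?dot_lcr// in h3; do ?exact: l2_lc.
rewrite (dotC v f) in h3.
move: h1 h2 h3; set a := dot v v; set b := dot f v; set e := dot f f => h1 h2 h3.
have ce : c ^+ 2 * a <= 4 * e.
  have : c * (c / 2 * a) <= c * b by rewrite ler_pM2l//; lra.
  nra.
by rewrite mulrAC ler_pdivlMr ?exprn_gt0// mulrC.
Qed.

Let jacobi_cvg n : exists l : R, jacobi i n @[i --> \oo] --> l.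
Proof.
exists (sup (range (jacobi ^~ n))).
apply: nondecreasing_cvgn.
  by apply/nondecreasing_seqP => i; exact: jacobi_nd.
exists (1 + 4 / c ^+ 2 * dot f f) => _ [i _ <-].
have := fin_le_rsum [fset n]%fset (fun n => sqr_ge0 (jacobi i n)) (jacobi_l2 i).
rewrite big_seq_fset1 => h.
have := le_trans h (jacobi_bound i).
by move: (jacobi_ge0 i n); nra.
Qed.

(** The iterates increase and are bounded in l2, so they converge
    pointwise; the limit is a fixed point because each equation involves
    finitely many sites. *)
Lemma lop_surj_nneg : exists2 v, l2 v & lop c q v = f.
Proof.
have [v vl] := choice jacobi_cvg.
have lv : l2 v.
  apply: (@fin_bound_asum _ _ _ (4 / c ^+ 2 * dot f f) _ _).1 => [n|F].
    exact: sqr_ge0.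
  have h : (fun i => \sum_(n <- F) jacobi i n ^+ 2) @ \oo -->
      \sum_(n <- F) v n ^+ 2.
    apply: cvg_finsum => n; exact: cvgM (vl n) (vl n).
  apply: (cvgr_to_le h); apply: nearW => i.
  apply: le_trans (jacobi_bound i).
  exact: (fin_le_rsum F (fun n => sqr_ge0 (jacobi i n)) (jacobi_l2 i)).
exists v => //; apply/funext => n.
have fixv : v n = (D n)^-1 * (f n + adj v n).
  have h1 : jacobi i.+1 n @[i --> \oo] --> v n.
    by rewrite (cvg_shiftS (fun i => jacobi i n)); exact: vl.
  have h2 : jacobi i.+1 n @[i --> \oo] --> (D n)^-1 * (f n + adj v n).
    apply: cvgM; first exact: cvg_cst.
    apply: cvgD; first exact: cvg_cst.
    have vl2 (k : 'I_d) : jacobi i (n + delta_mx ord0 k) +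
        jacobi i (n - delta_mx ord0 k) @[i --> \oo] -->
        v (n + delta_mx ord0 k) + v (n - delta_mx ord0 k).
      exact: cvgD (vl _) (vl _).
    exact: cvg_finsum vl2.
  exact: cvg_unique h1 h2.
by rewrite lopE {1}fixv mulVKf ?(gt_eqF (D_gt0 n))// addrK.
Qed.

End Iteration.

Lemma lop_surj q f : bounded_seq q -> (forall n, q n <= c / 2) -> l2 f ->
  exists2 v, l2 v & lop c q v = f.
Proof.
move=> bq qc lf.
pose p n := (`|f n| + f n) / 2; pose m n := (`|f n| - f n) / 2.
have p0 n : 0 <= p n.
  by rewrite divr_ge0//; have := ler_norm (- f n); rewrite normrN; lra.
have m0 n : 0 <= m n by rewrite divr_ge0//; have := ler_norm (f n); lra.
have lp : l2 p.
  apply: l2_le lf _ => n; rewrite ger0_norm// /p.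
  have := ler_norm (f n); lra.
have lm : l2 m.
  apply: l2_le lf _ => n; rewrite ger0_norm// /m.
  have := ler_norm (- f n); rewrite normrN; lra.
have [v lv vp] := lop_surj_nneg bq qc lp p0.
have [w lw wm] := lop_surj_nneg bq qc lm m0.
exists (lc 1 v (-1) w); first exact: l2_lc.
by rewrite lop_lc vp wm; apply/funext => n; rewrite /lc /p /m; lra.
Qed.

Definition site (s : lattice d) : lattice d -> R := fun n => (n == s)%:R.

Lemma l2_site_le1 s : l2 (site s) /\ dot (site s) (site s) <= 1.
Proof.
apply: fin_bound_asum => [n|F]; first exact: sqr_ge0.
have [sF|sF] := boolP (s \in F).
  rewrite (big_fsetD1 s)//= big_seq big1 ?addr0; last first.
    by move=> n; rewrite !inE /site => /andP[/negPf->]; rewrite expr0n.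
  by rewrite /site eqxx expr1n.
rewrite big_seq big1 ?ler01// => n nF; rewrite /site.
by case: eqVneq => [e|_]; [rewrite e (negPf sF) in nF|rewrite expr0n].
Qed.

Lemma l2_site s : l2 (site s).
Proof. exact: (l2_site_le1 s).1. Qed.

Lemma dot_site s x : l2 x -> dot x (site s) = x s.
Proof.
move=> lx; have [ls s1] := l2_site_le1 s.
have dss : dot (site s) (site s) = 1.
  apply/eqP; rewrite eq_le s1/=.
  have := fin_le_rsum [fset s]%fset (fun n => sqr_ge0 (site s n)) ls.
  by rewrite big_seq_fset1 /site eqxx expr1n.
rewrite -[RHS]mulr1 -dss /dot -rsumZ; last exact: asum_mul.
congr rsum; apply/funext => n; rewrite /site.
by case: eqVneq => [->|]; rewrite ?mulr0 ?mulr1.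
Qed.

End Solve.

(** * Fredholm decomposition by rank one perturbations *)

Section Fredholm.
Variables (R : realType) (d : nat) (c : R).
Implicit Types (f g h k x y z q : lattice d -> R).
Hypothesis c0 : 0 < c.

Local Notation L := (lop c).

(** The form of the Fredholm alternative that survives a rank one
    perturbation: range and kernel together span the space. *)
Definition range_plus_ker q f := exists g k,
  [/\ l2 g, l2 k, L q k = (fun=> 0) & f = lc 1 (L q g) 1 k].

Definition fredholm q := forall f, l2 f -> range_plus_ker q f.

Lemma lop0 q : L q (fun=> 0) = fun=> 0.
Proof.
apply/funext => n; rewrite lopE mulr0 /adj big1 ?subr0// => k _.
by rewrite addr0.
Qed.

Lemma range_plus_ker_lc q a f b g : range_plus_ker q f -> range_plus_ker q g ->
  range_plus_ker q (lc a f b g).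
Proof.
move=> [x [k [lx lk Lk ->]]] [y [m [ly lm Lm ->]]].
exists (lc a x b y), (lc a k b m); split; [exact: l2_lc|exact: l2_lc| |].
  by rewrite lop_lc Lk Lm; apply/funext => n; rewrite /lc !mulr0 addr0.
by rewrite lop_lc; apply/funext => n; rewrite /lc; ring.
Qed.

Lemma range_plus_ker_range q g : l2 g -> range_plus_ker q (L q g).
Proof.
move=> lg; exists g, (fun=> 0); split => //; [exact: l2_0|exact: lop0|].
by apply/funext => n; rewrite /lc; ring.
Qed.

Lemma range_plus_ker_ker q k : l2 k -> L q k = (fun=> 0) -> range_plus_ker q k.
Proof.
move=> lk Lk; exists (fun=> 0), k; split => //; first exact: l2_0.
by rewrite lop0; apply/funext => n; rewrite /lc; ring.
Qed.

Lemma fredholm_coercive q : bounded_seq q -> (forall n, q n <= c / 2) ->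
  fredholm q.
Proof.
move=> bq qc f lf; have [g lg <-] := lop_surj c0 bq qc lf.
exact: range_plus_ker_range.
Qed.

Lemma lop_addsite q s (v : R) x :
  L (lc 1 q v (site R s)) x = lc 1 (L q x) (- (v * x s)) (site R s).
Proof.
apply/funext => n; rewrite /lc !lopE /site.
by case: eqVneq => [->|_] /=; ring.
Qed.

(** Let L be the operator for q and L' the one for the perturbed potential;
    they agree up to multiples of the unit vector e at the site, and kernel
    vectors of L vanishing at the site stay in the kernel of L'. So everything
    reduces to decomposing e itself for L'. Write e = L h + k with L k = 0;
    then k(s) = <k, k>. If k(s) <> 0, then L' k is a nonzero multiple of e.
    Otherwise e = L h, so L' h is a multiple of e; the remaining case is
    L' h = 0, in which decomposing h for L expresses e. *)
Lemma fredholm_site q s (v : R) : bounded_seq q ->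
  fredholm q -> fredholm (lc 1 q v (site R s)).
Proof.
move=> bq Fq.
have [-> | v0] := eqVneq v 0.
  by rewrite (_ : lc 1 q 0 _ = q)//; apply/funext => n; rewrite /lc; ring.
set q' := lc 1 q v (site R s); set e := site R s.
have le : l2 e by exact: l2_site.
have es : e s = 1 by rewrite /e /site eqxx.
have Lx x : L q' x = lc 1 (L q x) (- (v * x s)) e by exact: lop_addsite.
have LE x : L q x = lc 1 (L q' x) (v * x s) e.
  by rewrite Lx; apply/funext => n; rewrite /lc; ring.
have lL x : l2 x -> l2 (L q x) by exact: l2_lop.
have ker_s k : l2 k -> L q k = (fun=> 0) -> k s = 0 -> range_plus_ker q' k.
  move=> lk Lk ks; apply: range_plus_ker_ker => //.
  by rewrite Lx Lk ks; apply/funext => n; rewrite /lc; ring.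
have ker_range x k := @lop_range_ker R d c q x k bq.
have [h [k [lh lk Lk eE]]] := Fq e le.
have ksE : k s = dot k k.
  rewrite -(dot_site s lk) -/e eE dot_lcr ?(dotC k)//; last exact: lL.
  by rewrite ker_range//; ring.
have k_s0 : k s = 0 -> e = L q h.
  rewrite ksE => /(dot_eq0 lk) k0.
  by rewrite eE k0; apply/funext => n; rewrite /lc; ring.
have ker_at_s m : k s = 0 -> l2 m -> L q m = (fun=> 0) -> m s = 0.
  by move=> /k_s0 eh lm Lm; rewrite -(dot_site s lm) -/e eh dotC ker_range.
have Ee : range_plus_ker q' e.
  have [ks0|ks] := eqVneq (k s) 0; last first.
    rewrite [e](_ : _ = L q' (lc (- (v * k s)^-1) k 0 k)); last first.
      rewrite lop_lc Lx Lk; apply/funext => n; rewrite /lc; field.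
      by rewrite v0 ks.
    by apply: range_plus_ker_range; exact: l2_lc.
  have eh := k_s0 ks0.
  have L'h : L q' h = lc (1 - v * h s) e 0 e.
    by rewrite Lx -eh; apply/funext => n; rewrite /lc; ring.
  have [vh|vh] := eqVneq (1 - v * h s) 0; last first.
    rewrite [e](_ : _ = L q' (lc (1 - v * h s)^-1 h 0 h)); last first.
      by rewrite lop_lc L'h; apply/funext => n; rewrite /lc; field.
    by apply: range_plus_ker_range; exact: l2_lc.
  have [g [m [lg lm Lm hE]]] := Fq h lh.
  (* here g(s) = <g, L h> = <L g, h> = <L g, L g>, as L g and m are
     orthogonal; it can vanish only if h lies in the kernel of L, against L h
     = e *)
  have gs : g s != 0.
    apply/eqP => gs.
    have Lg0 : L q g = fun=> 0.
      apply: dot_eq0; first exact: lL.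
      have : dot (L q g) h = 0.
        by rewrite lop_sym// -eh dot_site.
      have lLg := lL g lg; rewrite [X in dot _ X]hE dot_lcr//.
      rewrite (ker_range g m)// => h1; lra.
    have : e s = 0.
      rewrite eh hE Lg0 lop_lc Lm lop0 /lc; ring.
    by rewrite es => /eqP; rewrite oner_eq0.
  rewrite [e](_ : _ = lc (v * g s)^-1 (lc 1 h (-1) m) (- (v * g s)^-1) (L q' g)).
    apply: range_plus_ker_lc; last exact: range_plus_ker_range.
    apply: range_plus_ker_lc.
      apply: range_plus_ker_ker => //.
      by rewrite L'h vh; apply/funext => n; rewrite /lc; ring.
    by apply: ker_s => //; exact: ker_at_s.
  rewrite {1}hE Lx; apply/funext => n; rewrite /lc; field.
  by rewrite v0 gs.
have EL x : l2 x -> range_plus_ker q' (L q x).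
  by move=> lx; rewrite LE; apply: range_plus_ker_lc => //;
    exact: range_plus_ker_range.
have Ek : range_plus_ker q' k.
  rewrite [k](_ : _ = lc 1 e (-1) (L q h)).
    by apply: range_plus_ker_lc => //; exact: EL.
  by rewrite eE; apply/funext => n; rewrite /lc; ring.
move=> f lf; have [g [m [lg lm Lm ->]]] := Fq f lf.
apply: range_plus_ker_lc; first exact: EL.
have [ks0|ks] := eqVneq (k s) 0.
  by apply: ker_s => //; exact: ker_at_s.
rewrite [m](_ : _ = lc 1 (lc 1 m (- (m s / k s)) k) (m s / k s) k); last first.
  by apply/funext => n; rewrite /lc; ring.
apply: range_plus_ker_lc => //; apply: ker_s; first exact: l2_lc.
  by rewrite lop_lc Lm Lk; apply/funext => n; rewrite /lc; ring.
by rewrite /lc; field.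
Qed.

(** Induction on the sites where the potential is too large for
    coercivity. *)
Lemma fredholm_lop q (F : seq (lattice d)) : bounded_seq q ->
  (forall n, n \notin F -> q n <= c / 2) -> fredholm q.
Proof.
elim: F q => [|s F IH] q bq qF; first by apply: fredholm_coercive => // n; exact: qF.
pose q' := lc 1 q (- q s) (site R s).
have q's n : q' n = if n == s then 0 else q n.
  by rewrite /q' /lc /site; case: eqVneq => [->|_] /=; ring.
rewrite (_ : q = lc 1 q' (q s) (site R s)); last first.
  by apply/funext => n; rewrite /q' /lc; ring.
have bq' : bounded_seq q'.
  have [C qC] := bq; exists C => n; rewrite q's.
  by case: ifP => // _; rewrite normr0 (le_trans _ (qC s)).
apply: fredholm_site => //; apply: IH => // n nF; rewrite q's.
case: eqVneq => [_|ns]; first by rewrite divr_ge0 ?ltW.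
by apply: qF; rewrite inE negb_or ns.
Qed.

(** Decomposing f = L g + k, the kernel part k is orthogonal to f and to
    the range, so it vanishes. Decomposing g = L x + m in turn, L x is a
    solution as well, and it lies in the range, which is orthogonal to the
    kernel. *)
Lemma lop_solve q f : bounded_seq q -> fredholm q -> l2 f ->
  (forall k, l2 k -> L q k = (fun=> 0) -> dot f k = 0) ->
  exists g, [/\ l2 g, L q g = f
    & forall k, l2 k -> L q k = (fun=> 0) -> dot g k = 0].
Proof.
move=> bq Fq lf fK.
have [g [k [lg lk Lk fE]]] := Fq f lf.
have [x [m [lx lm Lm gE]]] := Fq g lg.
have k0 : k = fun=> 0.
  apply: dot_eq0 => //; have := fK k lk Lk.
  have lLg : l2 (L q g) by exact: l2_lop.
  rewrite [X in dot X _]fE dot_lcl// lop_range_ker// => h; lra.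
have lLx : l2 (L q x) by exact: l2_lop.
exists (L q x); split => //; last by move=> y ly Ly; exact: lop_range_ker.
rewrite fE k0 gE lop_lc Lm; apply/funext => n; rewrite /lc; ring.
Qed.

End Fredholm.

(** * Scalar inequalities for real powers *)

Section PowerInequalities.
Variable R : realType.
Implicit Types a b h p r s x y z : R.

(** Convexity of the power, in the guise of the Young inequality for
    x and a^(p - 1). *)
Lemma powR_tangent p a x : 1 < p -> 0 <= a -> 0 <= x ->
  a `^ p + p * a `^ (p - 1) * (x - a) <= x `^ p.
Proof.
move=> p1 a0 x0; have p0 : 0 < p by lra.
have p'0 : 0 < p - 1 by lra.
have := conjugate_powR x0 (powR_ge0 a (p - 1)) p0 (divr_gt0 p0 p'0).
rewrite -powRrM (_ : (p - 1) * (p / (p - 1)) = p); last by field; lra.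
have -> : p^-1 + (p / (p - 1))^-1 = 1 by field; lra.
move=> /(_ erefl) h.
have aE := mulr_powRB1 a0 p0.
set w := a `^ (p - 1) in h aE *; set b := a `^ p in h aE *.
set y := x `^ p in h *.
have : p * (x * w) <= p * (y / p + b / (p / (p - 1))) by rewrite ler_pM2l.
have -> : p * (y / p + b / (p / (p - 1))) = y + (p - 1) * b by field; lra.
by rewrite -aE; lra.
Qed.

Lemma powR_MVT s a b : 0 < a -> a < b ->
  exists2 z, a < z < b & b `^ s - a `^ s = s * z `^ (s - 1) * (b - a).
Proof.
move=> a0 ab.
have der x : a <= x -> is_derive x 1 (fun x => x `^ s) (s * x `^ (s - 1)).
  by move=> ax; apply: is_derive1_powR; exact: lt_le_trans a0 ax.
have [x|//|z] := @MVT R (fun x => x `^ s) (fun x => s * x `^ (s - 1)) a b ab.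
- by rewrite in_itv/= => /andP[/ltW/der].
- apply: derivable_within_continuous => x; rewrite in_itv/= => /andP[ax _].
  by case: (der x ax).
by rewrite in_itv /= => zab e; exists z.
Qed.

Lemma powR_near1 s e : 0 < e -> exists2 del, 0 < del <= 1 &
  forall z, `|z - 1| < del -> 1 - e < z `^ s.
Proof.
move=> e0.
have cont : {for (1 : R), continuous (fun x : R => x `^ s)}.
  apply/differentiable_continuous/derivable1_diffP.
  by case: (@is_derive1_powR R s 1 ltr01).
have : \forall z \near (1 : R), 1 - e < z `^ s.
  have h : z `^ s @[z --> (1 : R)] --> (1 : R) `^ s := cont.
  rewrite powR1 in h.
  by apply: (cvgr_gt _ h); lra.
move=> /nbhs_ballP[del /= del0 H].
exists (Num.min del 1); first by rewrite lt_min del0 ltr01 ge_min lexx orbT.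
move=> z; rewrite lt_min => /andP[zd _]; apply: H.
by rewrite /ball/= distrC.
Qed.

(** Sign form of a first order expansion of (1 + z)^r at 0: the
    difference from 1 + m z has the sign of z when m is less than the
    derivative r. *)
Lemma powR_near1_slope r m : 0 < r -> m < r ->
  exists2 del, 0 < del <= 1 & forall z, `|z| < del ->
    0 <= ((1 + z) `^ r - 1 - m * z) * z.
Proof.
move=> r0 mr.
have e0 : 0 < (r - m) / r by rewrite divr_gt0// subr_gt0.
have [del d01 H] := powR_near1 (r - 1) e0.
exists del => // z zd.
have slope w : `|w - 1| < del -> m < r * w `^ (r - 1).
  move=> /H h; have : r * (1 - (r - m) / r) < r * w `^ (r - 1).
    by rewrite ltr_pM2l.
  by rewrite (_ : r * _ = m)//; field; lra.
move: zd d01; rewrite ltr_norml => /andP[z1 z2] /andP[d0 d1].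
have [z0|z0|->] := ltgtP z 0; last by rewrite mulr0.
- have [w /andP[w1 w2] E] := @powR_MVT r (1 + z) 1 ltac:(lra) ltac:(lra).
  have := slope w; rewrite ltr_norml => /(_ ltac:(apply/andP; split; lra)) h.
  rewrite powR1 in E; nra.
- have [w /andP[w1 w2] E] := @powR_MVT r 1 (1 + z) ltac:(lra) ltac:(lra).
  have := slope w; rewrite ltr_norml => /(_ ltac:(apply/andP; split; lra)) h.
  rewrite powR1 in E; nra.
Qed.

(** The difference of the two sides vanishes at 0, and by
    [powR_near1_slope] its derivative has the sign of h. *)
Lemma powR_taylor2 p k : 1 < p -> k < p * (p - 1) / 2 ->
  exists2 del, 0 < del <= 1 & forall h, `|h| < del ->
    1 + p * h + k * h ^+ 2 <= (1 + h) `^ p.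
Proof.
move=> p1 kp; have p0 : 0 < p by lra.
have p'0 : 0 < p - 1 by lra.
have mr : 2 * k / p < p - 1 by rewrite ltr_pdivrMr//; lra.
have [del d01 H] := powR_near1_slope p'0 mr.
exists del => // h hd.
pose g (x : R) := (1 + x) `^ p - (1 + p * x + k * x ^+ 2).
pose g' (x : R) := p * ((1 + x) `^ (p - 1) - 1 - 2 * k / p * x).
have der x : -1 < x -> is_derive x 1 g (g' x).
  move=> x1.
  have x0 : 0 < 1 + x by lra.
  have hp := @is_derive1_powR R p (1 + x) x0.
  have idx := @is_derive_id R R x 1.
  have cstx y := @is_derive_cst R R R y x 1.
  have h2 := @is_derive1_comp R (fun y : R => y `^ p) (cst (1 : R) + id) x _ _ hp
    (is_deriveD (cstx 1) idx).
  have h3 := is_deriveD (is_deriveD (cstx 1) (is_deriveM (cstx p) idx))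
    (is_deriveM (cstx k) (is_deriveM idx idx)).
  have := is_deriveB h2 h3.
  rewrite (_ : _ - _ = g); last by apply/funext.
  rewrite (_ : _ - _ = g' x)//.
  by rewrite /g' /GRing.scale/=; field; lra.
suff : 0 <= g h by rewrite /g subr_ge0.
have g0 : g 0 = 0 by rewrite /g addr0 powR1; ring.
have sgn x : `|x| < del -> 0 <= g' x * x.
  by move=> /H hx; rewrite /g' -mulrA; apply: mulr_ge0 => //; exact: ltW.
move: (hd) d01; rewrite ltr_norml => /andP[z1 z2] /andP[d0 d1].
have mvt x y : -1 < x -> x < y ->
    exists2 w, x < w < y & g y - g x = g' w * (y - x).
  move=> x1 xy; have [z|//|w] := @MVT R g g' x y xy.
  - by rewrite in_itv/= => /andP[xz _]; apply: der; lra.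
  - apply: derivable_within_continuous => z; rewrite in_itv/= => /andP[xz _].
    by case: (der z ltac:(lra)).
  by rewrite in_itv/= => wxy e; exists w.
have [h0|h0|->] := ltgtP h 0; last by rewrite g0.
- have [w /andP[w1 w2] E] := mvt h 0 ltac:(lra) h0.
  have := sgn w; rewrite ltr_norml => /(_ ltac:(apply/andP; split; lra)).
  rewrite g0 in E; nra.
- have [w /andP[w1 w2] E] := mvt 0 h ltac:(lra) h0.
  have := sgn w; rewrite ltr_norml => /(_ ltac:(apply/andP; split; lra)).
  rewrite g0 in E; nra.
Qed.

Lemma ge0_quadratic_limit a b e del : 0 < del ->
  (forall t, 0 < t < del -> 0 <= a + t * b + t ^+ 2 * e) -> 0 <= a.
Proof.
move=> d0 H; rewrite leNgt; apply/negP => a0.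
set S := `|b| + `|e| + 1.
have S0 : 0 < S by rewrite ltr_wpDl// addr_ge0.
pose t := Num.min (del / 2) (Num.min 1 (- a / (2 * S))).
have t0 : 0 < t by rewrite !lt_min divr_gt0//= ltr01 divr_gt0// ?oppr_gt0 ?mulr_gt0.
have t1 : t <= 1 by rewrite !ge_min lexx orbT.
have td : t < del.
  have : t <= del / 2 by rewrite ge_min lexx.
  by have := d0; lra.
have tS : t * S <= - a / 2.
  have : t <= - a / (2 * S) by rewrite !ge_min lexx !orbT.
  rewrite ler_pdivlMr ?mulr_gt0// => ?; lra.
have := H t; rewrite t0 td => /(_ isT).
have bb := ler_norm b; have ee := ler_norm e.
have : t * b <= t * `|b| by rewrite ler_pM2l.
have : t ^+ 2 * e <= t * `|e|.
  apply: le_trans (_ : t ^+ 2 * `|e| <= _); first by rewrite ler_wpM2l// sqr_ge0.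
  by rewrite ler_wpM2r// expr2 -[leRHS]mulr1 ler_pM2l.
by move: tS; rewrite /S; lra.
Qed.

End PowerInequalities.

(** * The Hamiltonian in real coordinates *)

Section Hamiltonian.
Variables (R : realType) (d : nat).
Implicit Types (x y z : lattice d -> R) (w : lattice d -> R[i]).

Definition cseq x y : lattice d -> R[i] := fun n => x n +i* y n.

Lemma cseqE w : w = cseq (fun n => complex.Re (w n)) (fun n => complex.Im (w n)).
Proof. by apply/funext => n; rewrite /cseq; case: (w n). Qed.

Lemma normc_sqr (z : R[i]) :
  Normc.normc z ^+ 2 = complex.Re z ^+ 2 + complex.Im z ^+ 2.
Proof. by case: z => a b; rewrite /= sqr_sqrtr// addr_ge0 ?sqr_ge0. Qed.

Lemma sqnorm_cseq x y : l2 x -> l2 y ->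
  sqnorm (cseq x y) = (dot x x + dot y y)%:E.
Proof.
move=> lx ly; rewrite /sqnorm /dot -rsumD ?asum_mul//.
rewrite -esum_rsum; last by apply: asumD; exact: asum_mul.
  by apply: eq_esum => n _; rewrite normc_sqr.
by move=> n; rewrite -!expr2 addr_ge0 ?sqr_ge0.
Qed.

Lemma in_l2_cseq x y : in_l2 (cseq x y) <-> l2 x /\ l2 y.
Proof.
split=> [h|[lx ly]]; last by rewrite /in_l2 sqnorm_cseq// ltry.
split; apply: esum_asum => [n|]; rewrite ?sqr_ge0//; apply: le_lt_trans h.
all: apply: le_esum => n _; rewrite normc_sqr lee_fin /=.
  by rewrite lerDl sqr_ge0.
by rewrite lerDr sqr_ge0.
Qed.

Definition dirichlet x : R := dot (lop 0 (fun=> 0) x) x.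

Definition edge_energy x : lattice d -> R := fun n =>
  \sum_(k < d) ((x n - x (n + delta_mx ord0 k)) ^+ 2 +
                (x n - x (n - delta_mx ord0 k)) ^+ 2).

Lemma edge_energy_ge0 x n : 0 <= edge_energy x n.
Proof. by apply: sumr_ge0 => k _; rewrite addr_ge0 ?sqr_ge0. Qed.

Lemma rsum_sqr_diff x y : l2 x -> l2 y ->
  asum (fun n => (x n - y n) ^+ 2) /\
  rsum (fun n => (x n - y n) ^+ 2) = dot x x - 2 * dot x y + dot y y.
Proof.
move=> lx ly; rewrite -dot_lc_diff//.
have e : (fun n => (x n - y n) ^+ 2) =
         fun n => lc 1 x (-1) y n * lc 1 x (-1) y n.
  by apply/funext => n; rewrite /lc; ring.
by rewrite e; split => //; apply: asum_mul; exact: l2_lc.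
Qed.

(** Summation by parts: [edge_energy] meets every edge from both of its
    ends. *)
Lemma rsum_edge_energy x : l2 x ->
  asum (edge_energy x) /\ rsum (edge_energy x) = 2 * dirichlet x.
Proof.
move=> lx.
have se (e : lattice d) := rsum_sqr_diff lx (l2_shift e lx).
have sk (k : 'I_d) : asum (fun n => (x n - x (n + delta_mx ord0 k)) ^+ 2 +
                           (x n - x (n - delta_mx ord0 k)) ^+ 2).
  by apply: asumD; [exact: (se _).1|exact: (se _).1].
have [s1 s2] := rsum_sum (index_enum 'I_d) sk.
split; first exact: s1.
rewrite [LHS]s2 /dirichlet lop_adj dot_lcl//; last exact: l2_adj.
  rewrite dot_adj// mul1r mulN1r mulrBr.
  have -> : 2 * dot (fun n => ((2 * d)%:R + 0 - 0) * x n) x =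
      \sum_(k < d) (4 * dot x x).
    rewrite sumr_const card_ord -[RHS]mulr_natl.
    rewrite (_ : dot _ x = (2 * d)%:R * dot x x); last first.
      rewrite /dot -rsumZ; last exact: asum_mul.
      by congr rsum; apply/funext => n; ring.
    by rewrite natrM; ring.
  rewrite [X in _ - X]mulr_sumr -sumrN -big_split /=; apply: eq_bigr => k _.
  rewrite rsumD; [|exact: (se _).1|exact: (se _).1].
  rewrite (se _).2 (se (- delta_mx ord0 k)).2 !dot_shiftE.
  rewrite !(dotC x); ring.
apply: l2_bounded_mul => //; exists `|(2 * d)%:R| => n.
by rewrite addr0 subr0.
Qed.

Lemma finite_neighbors (n : lattice d) : finite_set (neighbors n).
Proof.
by rewrite neighborsE finite_setU; split; apply: finite_image; exact: finite_finset.
Qed.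

(** The inner sum over the neighbours of a site is turned into a sum over
    directions by [disc_laplacianE], applied to a function that vanishes at
    the site. *)
Lemma esum_edges w x y : w = cseq x y -> l2 x -> l2 y ->
  (\esum_(p in [set p : lattice d * lattice d | neighbors p.2 p.1])
     ((Normc.normc (w p.1 - w p.2)) ^+ 2)%:E)%E =
  (2 * (dirichlet x + dirichlet y))%:E.
Proof.
move=> -> lx ly; set w' := cseq x y.
have -> : [set p : lattice d * lattice d | neighbors p.2 p.1] =
    [set: lattice d] `*`` neighbors (d := d).
  apply/seteqP; split => -[m n] /=; rewrite /neighbors /=.
    by move=> h; split=> //; rewrite -h; apply: eq_bigr => k _; ring.
  by move=> [_ <-]; apply: eq_bigr => k _; ring.
rewrite -(esum_esum (a := fun m n => ((Normc.normc (w' m - w' n)) ^+ 2)%:E)); last first.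
  by move=> m n _ _; rewrite lee_fin sqr_ge0.
have [ax rx] := rsum_edge_energy lx; have [ay ry] := rsum_edge_energy ly.
rewrite mulrDr -rx -ry -rsumD// -esum_rsum; last exact: asumD.
  apply: eq_esum => n _.
  rewrite esum_fset; [|exact: finite_neighbors|]; last first.
    by move=> m _; rewrite lee_fin sqr_ge0.
  rewrite fsumEFin; last exact: finite_neighbors.
  congr (_%:E); pose F m := Normc.normc (w' n - w' m) ^+ 2.
  have := disc_laplacianE F n; rewrite /disc_laplacian => /addIr ->.
  rewrite -big_split /=; apply: eq_bigr => k _.
  by rewrite /F !normc_sqr /=; ring.
by move=> n; rewrite addr_ge0 ?edge_energy_ge0.
Qed.

(** A summable nonnegative family is bounded, so its power sigma + 1 is
    dominated by a multiple of it. *)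
Lemma asum_powR sigma (a : lattice d -> R) : 0 < sigma ->
  (forall n, 0 <= a n) -> asum a -> asum (fun n => a n `^ (sigma + 1)).
Proof.
move=> s0 a0 sa.
apply: asum_le (asumZ (rsum a `^ sigma) sa) _ => n.
rewrite !ger0_norm ?powR_ge0 ?mulr_ge0 ?powR_ge0//.
rewrite -(mulr_powRB1 (a0 n)) ?addr_gt0// addrK mulrC ler_wpM2r//.
apply: ge0_ler_powR; rewrite ?nnegrE ?rsum_ge0 ?(ltW s0)//.
by have := fin_le_rsum [fset n]%fset a0 sa; rewrite big_seq_fset1.
Qed.

Lemma hamiltonian_cseq sigma x y : 0 < sigma -> l2 x -> l2 y ->
  hamiltonian sigma (cseq x y) = dirichlet x + dirichlet y -
    (sigma + 1)^-1 * rsum (fun n => (x n ^+ 2 + y n ^+ 2) `^ (sigma + 1)).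
Proof.
move=> s0 lx ly; rewrite /hamiltonian (esum_edges (x := x) (y := y))//=.
congr (_ - _ * _); first by field.
rewrite rsum_ge0E; last by move=> n; exact: powR_ge0.
congr fine; apply: eq_esum => n _; congr (_%:E).
rewrite (_ : 2 * sigma + 2 = 2 * (sigma + 1)); last by ring.
rewrite powRrM /= powR_mulrn ?sqrtr_ge0// sqr_sqrtr//.
by rewrite addr_ge0 ?sqr_ge0.
Qed.

End Hamiltonian.

(** * Second variation at the minimizer *)

Section SecondVariation.
Variables (R : realType) (d : nat) (sigma lambda c : R) (u : lattice d -> R).
Implicit Types (x y z : lattice d -> R).
Hypotheses (s0 : 0 < sigma) (lam0 : 0 < lambda).
Hypothesis wave : normalized_wave sigma lambda c u.

Definition pot : lattice d -> R := fun n => u n `^ (2 * sigma).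

Lemma wave_ge0 n : 0 <= u n. Proof. by case: wave. Qed.

Lemma c_gt0 : 0 < c. Proof. by case: wave. Qed.

Lemma complexify_cseq x : complexify x = cseq x (fun=> 0).
Proof. by []. Qed.

Lemma wave_l2 : l2 u.
Proof.
have [_ h _ _ _] := wave.
have : in_l2 (complexify u) by rewrite /in_l2 h ltry.
by rewrite complexify_cseq => /in_l2_cseq[].
Qed.

Lemma dirichlet0 : dirichlet (fun _ : lattice d => 0 : R) = 0.
Proof. exact: dot0r. Qed.

Lemma wave_mass : dot u u = lambda.
Proof.
have [_ h _ _ _] := wave.
move: h; rewrite complexify_cseq sqnorm_cseq; [|exact: wave_l2|exact: l2_0].
by rewrite dot0l addr0 => -[].
Qed.

Lemma pot_ge0 n : 0 <= pot n. Proof. exact: powR_ge0. Qed.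

Lemma bounded_pot : bounded_seq pot.
Proof.
have [C uC] := l2_bounded wave_l2; exists (C `^ (2 * sigma)) => n.
rewrite ger0_norm ?pot_ge0//.
have un : u n <= C by rewrite -(ger0_norm (wave_ge0 n)).
have u0 := wave_ge0 n.
by apply: ge0_ler_powR => //; rewrite ?nnegrE ?mulr_ge0 ?(ltW s0) ?(le_trans u0 un).
Qed.

Lemma u_pot n : u n * pot n = u n `^ (2 * sigma + 1).
Proof.
have s20 : 0 < 2 * sigma + 1 by have := s0; lra.
by rewrite -(mulr_powRB1 (wave_ge0 n) s20) addrK.
Qed.

Lemma u2_pot n : u n ^+ 2 * pot n = (u n ^+ 2) `^ (sigma + 1).
Proof.
rewrite -(mulr_powRB1 (sqr_ge0 (u n))) ?addr_gt0// addrK; congr (_ * _).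
by rewrite /pot powRrM powR_mulrn ?wave_ge0.
Qed.

Lemma stationary : lop 0 (fun=> 0) u = lc 1 (fun n => pot n * u n) (- c) u.
Proof.
have [_ _ _ _ h] := wave.
by apply/funext => n; have := h n; rewrite /lop /lc -u_pot; lra.
Qed.

Lemma bounded0 : bounded_seq (fun _ : lattice d => 0 : R).
Proof. by exists 0 => n; rewrite normr0. Qed.

Lemma dirichlet_ge0 x : l2 x -> 0 <= dirichlet x.
Proof.
move=> lx; have [_ h] := rsum_edge_energy lx.
have : 0 <= rsum (edge_energy x) by apply: rsum_ge0; exact: edge_energy_ge0.
by rewrite h; lra.
Qed.

Lemma dirichlet_lc a x b y : l2 x -> l2 y -> dirichlet (lc a x b y) =
  a ^+ 2 * dirichlet x + 2 * a * b * dot (lop 0 (fun=> 0) x) y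
  + b ^+ 2 * dirichlet y.
Proof.
move=> lx ly; have b0 := bounded0.
have lLx := l2_lop 0 b0 lx; have lLy := l2_lop 0 b0 ly.
have lxy := l2_lc a b lx ly.
rewrite /dirichlet lop_lc dot_lcl// !dot_lcr//.
rewrite [dot (lop _ _ y) x](lop_sym 0 b0 ly lx) [dot y _]dotC; ring.
Qed.

Lemma mass_lc a x b y : l2 x -> l2 y ->
  dot (lc a x b y) (lc a x b y) =
  a ^+ 2 * dot x x + 2 * a * b * dot x y + b ^+ 2 * dot y y.
Proof.
move=> lx ly; have lxy := l2_lc a b lx ly.
by rewrite dot_lcl// !dot_lcr// (dotC y x); ring.
Qed.

Lemma l2_pot_mul x : l2 x -> l2 (fun n => pot n * x n).
Proof. by apply: l2_bounded_mul; exact: bounded_pot. Qed.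

(** The competitor is u + t (x + i y) divided by
    (1 + t^2 m / lambda)^(1/2), where m = <x, x> + <y, y>; this normalizes the
    mass since x is orthogonal to u. The hypothesis bounds its nonlinear
    energy from below by a polynomial in t, so that minimality becomes a
    polynomial inequality, whose coefficients of order 0 and 1 cancel by the
    equation of the wave. The coefficient of t^2 is the claim. *)
Lemma second_variation x y (K del : R) : 0 < del -> l2 x -> l2 y ->
  dot u x = 0 ->
  (forall t, 0 < t < del ->
     dot (fun n => pot n * u n) u
       + 2 * (sigma + 1) * t * dot (fun n => pot n * u n) x
       + (sigma + 1) * t ^+ 2 * K
     <= rsum (fun n => ((u n + t * x n) ^+ 2 + (t * y n) ^+ 2) `^ (sigma + 1))) ->
  K <= dirichlet x + dirichlet y + c * (dot x x + dot y y).
Proof.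
move=> del0 lx ly ux HB.
have lu := wave_l2; have lpu := l2_pot_mul lu.
set be := dot (fun n => pot n * u n) x in HB.
set M := dot (fun n => pot n * u n) u in HB.
set e := dirichlet x + dirichlet y.
set m := dot x x + dot y y.
have m0 : 0 <= m by rewrite addr_ge0 ?dot_ge0.
pose q := sigma + 1.
have q1 : 1 < q by rewrite /q; have := s0; lra.
have M0 : 0 <= M.
  by apply: rsum_ge0 => n; rewrite -mulrA mulr_ge0 ?pot_ge0 -?expr2 ?sqr_ge0.
have Eu : dirichlet u = M - c * lambda.
  rewrite /dirichlet stationary dot_lcl// -/M wave_mass; ring.
have Dux : dot (lop 0 (fun=> 0) u) x = be.
  by rewrite stationary dot_lcl// ux -/be; ring.
have Hu : hamiltonian sigma (complexify u) = M - c * lambda - q^-1 * M.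
  rewrite complexify_cseq hamiltonian_cseq//; last exact: l2_0.
  rewrite Eu dirichlet0 addr0; congr (_ - _ * _); congr rsum; apply/funext => n.
  by rewrite expr0n/= addr0 -u2_pot; ring.
suff : 0 <= lambda * (e - K + c * m).
  by rewrite pmulr_rge0//; lra.
(* the bound lambda / (q (m + 1)) on t keeps 1 - q (1 - r) nonnegative below;
   the two coefficients are those of the identity checked by the final field
   call *)
apply: (@ge0_quadratic_limit R _ (2 * m * be * (q - 1)) (m * (q - 1) * K)
  (Num.min del (Num.min 1 (lambda / (q * (m + 1)))))).
  rewrite !lt_min del0 ltr01 divr_gt0// mulr_gt0//; lra.
move=> t; rewrite !lt_min => /andP[t0 /andP[td /andP[t1 tq]]].
pose N := lambda + t ^+ 2 * m.
have N0 : 0 < N by rewrite ltr_wpDr// mulr_ge0// sqr_ge0.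
pose r := lambda / N.
have r0 : 0 <= r by rewrite divr_ge0// ltW.
pose rt := Num.sqrt r.
have rt2 : rt ^+ 2 = r by rewrite sqr_sqrtr.
have lxu : l2 (lc 1 u t x) by exact: l2_lc.
pose X := lc rt (lc 1 u t x) 0 x; pose Y := lc (rt * t) y 0 y.
have lX : l2 X by exact: l2_lc.
have lY : l2 Y by exact: l2_lc.
have massXY : sqnorm (cseq X Y) = lambda%:E.
  rewrite sqnorm_cseq// /X /Y !mass_lc// ux wave_mass; congr (_%:E).
  rewrite !exprMn rt2 /r; have := N0; rewrite /N /m => N0'; field.
  by rewrite gt_eqF.
have EX : dirichlet X = r * (dirichlet u + 2 * t * be + t ^+ 2 * dirichlet x).
  rewrite dirichlet_lc// [dirichlet (lc 1 u t x)]dirichlet_lc// rt2 Dux; ring.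
have EY : dirichlet Y = r * t ^+ 2 * dirichlet y.
  by rewrite dirichlet_lc// exprMn rt2; ring.
have [_ _ minH _ _] := wave.
have := minH _ massXY; rewrite Hu hamiltonian_cseq//.
set B := rsum (fun n => ((u n + t * x n) ^+ 2 + (t * y n) ^+ 2) `^ (sigma + 1)) in HB *.
have -> : rsum (fun n => (X n ^+ 2 + Y n ^+ 2) `^ (sigma + 1)) = r `^ q * B.
  rewrite -rsumZ; last first.
    apply: asum_powR => // [n|]; first by rewrite addr_ge0 ?sqr_ge0.
    apply: asumD; last exact: l2Z.
    by apply: l2D => //; exact: l2Z.
  congr rsum; apply/funext => n.
  rewrite -powRM ?addr_ge0 ?sqr_ge0//; congr (_ `^ _).
  by rewrite /X /Y /lc -rt2; ring.
rewrite EX EY => minXY.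
have HBt : M + 2 * q * t * be + q * t ^+ 2 * K <= B by apply: HB; rewrite t0.
have B0 : 0 <= B by apply: rsum_ge0 => n; exact: powR_ge0.
have rN : r * N = lambda by rewrite divfK// gt_eqF.
(* replaces the power of the scaling factor by its tangent at 1, which is
   rational in t *)
have rq : 1 - q * (1 - r) <= r `^ q.
  have := powR_tangent q1 ler01 r0; rewrite !powR1; lra.
have g0 : 0 <= 1 - q * (1 - r).
  rewrite -(pmulr_lge0 _ N0) mulrBl mul1r -mulrA mulrBl mul1r rN /N.
  have : t * (q * (m + 1)) < lambda by rewrite -ltr_pdivlMr// mulr_gt0//; lra.
  have : t ^+ 2 * (q * m) <= t * (q * m).
    rewrite ler_wpM2r ?mulr_ge0//; first by lra.
    by rewrite expr2 ger_pMr// ltW.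
  have : 0 <= t * q by rewrite mulr_ge0 ?ltW//; lra.
  have : 0 <= t ^+ 2 * m by rewrite mulr_ge0 ?sqr_ge0.
  lra.
have h1 : (1 - q * (1 - r)) * (M + 2 * q * t * be + q * t ^+ 2 * K) <= r `^ q * B.
  apply: le_trans (_ : (1 - q * (1 - r)) * B <= _); first by rewrite ler_wpM2l.
  by rewrite ler_wpM2r.
have q0 : 0 < q by lra.
have h2 : q^-1 * ((1 - q * (1 - r)) * (M + 2 * q * t * be + q * t ^+ 2 * K))
    <= q^-1 * (r `^ q * B) by rewrite ler_wpM2l// invr_ge0 ltW.
have h3 : 0 <= N * (r * (dirichlet u + 2 * t * be + t ^+ 2 * e)
    - q^-1 * ((1 - q * (1 - r)) * (M + 2 * q * t * be + q * t ^+ 2 * K))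
    - (M - c * lambda - q^-1 * M)).
  rewrite mulr_ge0 ?(ltW N0)//; move: minXY h2; rewrite /e -/q.
  set P := q^-1 * (_ * B); set Q := q^-1 * (_ * (M + _ + _)); lra.
rewrite -(pmulr_rge0 _ (exprn_gt0 2 t0)); apply: le_trans h3 _.
rewrite Eu le_eqVlt; apply/orP; left; apply/eqP.
have -> : r = lambda / N by [].
have := N0; rewrite /N => N0'; field.
by rewrite !gt_eqF.
Qed.

Lemma dot_lop q x : bounded_seq q -> l2 x ->
  dot (lop c q x) x = dirichlet x + c * dot x x - dot (fun n => q n * x n) x.
Proof.
move=> bq lx; have lL := l2_lop 0 bounded0 lx; have lq := l2_bounded_mul bq lx.
have -> : lop c q x = lc 1 (lc 1 (lop 0 (fun=> 0) x) c x) (-1) (fun n => q n * x n).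
  by apply/funext => n; rewrite /lc /lop; ring.
by rewrite !dot_lcl//; [rewrite /dirichlet; ring|exact: l2_lc].
Qed.

Lemma pot_sqr n : (u n ^+ 2) `^ sigma = pot n.
Proof. by rewrite /pot powRrM powR_mulrn ?wave_ge0. Qed.

(** In the direction i y the modulus squared is u^2 + t^2 y^2, already of
    second order, so the tangent inequality at each site suffices. *)
Lemma lminus_ge0 y : l2 y -> 0 <= dot (lop c pot y) y.
Proof.
move=> ly; have lpy := l2_pot_mul ly; have lpu := l2_pot_mul wave_l2.
rewrite (dot_lop bounded_pot ly) subr_ge0.
have := @second_variation (fun=> 0) y (dot (fun n => pot n * y n) y) 1 ltr01
  (@l2_0 _ _) ly (dot0r u).
rewrite dirichlet0 dot0l !add0r; apply => t t01; rewrite dot0r mulr0 addr0.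
rewrite -rsumZ; last exact: asum_mul.
rewrite -rsumD; [|by apply: asum_mul => //; exact: wave_l2|]; last first.
  by apply: asumZ; exact: asum_mul.
apply: le_rsum.
- apply: asumD; first by apply: asum_mul => //; exact: wave_l2.
  by apply: asumZ; exact: asum_mul.
- apply: asum_powR => // [n|]; first by rewrite addr_ge0 ?sqr_ge0.
  apply: asumD; last exact: l2Z.
  by apply: l2D; [exact: wave_l2|exact/l2Z/l2_0].
move=> n; rewrite mulr0 addr0.
have s1 : 1 < sigma + 1 by have := s0; lra.
have h0 : 0 <= u n ^+ 2 + (t * y n) ^+ 2 by rewrite addr_ge0 ?sqr_ge0.
apply: le_trans (powR_tangent s1 (sqr_ge0 (u n)) h0).
rewrite -u2_pot addrK pot_sqr le_eqVlt; apply/orP; left; apply/eqP; ring.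
Qed.

(** Where u > 0, expand the power of 1 + h with h = t x / u; where u = 0,
    the left side vanishes. Finiteness of the set of sites provides a common
    range of t. *)
Lemma local_taylor x (k : R) (F : seq (lattice d)) : k < 2 * sigma + 1 ->
  exists2 del, 0 < del & forall t n, 0 < t < del -> n \in F ->
    u n ^+ 2 * pot n + 2 * (sigma + 1) * t * (pot n * u n * x n)
      + (sigma + 1) * t ^+ 2 * (k * (pot n * x n ^+ 2))
    <= ((u n + t * x n) ^+ 2) `^ (sigma + 1).
Proof.
move=> kp; elim: F => [|s F [del del0 IH]]; first by exists 1.
have [us|us] := eqVneq (u s) 0.
  exists del => // t n td; rewrite inE => /predU1P[->|]; last exact: IH.
  rewrite /pot us powR0; last by rewrite gt_eqF// mulr_gt0.
  rewrite !(mul0r, mulr0, addr0); exact: powR_ge0.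
have u0 : 0 < u s by rewrite lt_neqAle eq_sym us wave_ge0.
have p1 : 1 < 2 * (sigma + 1) by have := s0; lra.
have kk : (sigma + 1) * k < 2 * (sigma + 1) * (2 * (sigma + 1) - 1) / 2.
  have -> : 2 * (sigma + 1) * (2 * (sigma + 1) - 1) / 2 =
    (sigma + 1) * (2 * sigma + 1) by field.
  by rewrite ltr_pM2l// addr_gt0.
have [eps /andP[eps0 eps1] H] := powR_taylor2 p1 kk.
exists (Num.min del (eps * u s / (`|x s| + 1))).
  by rewrite lt_min del0 divr_gt0 ?mulr_gt0// ltr_wpDl.
move=> t n; rewrite lt_min => /andP[t0 /andP[td te]].
rewrite inE => /predU1P[->|]; last by apply: IH; rewrite t0.
set h := t * x s / u s.
have hE : t * x s = h * u s by rewrite /h divfK.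
have heps : `|h| < eps.
  rewrite /h normrM normfV (gtr0_norm u0) ltr_pdivrMr// normrM (gtr0_norm t0).
  apply: le_lt_trans (_ : t * (`|x s| + 1) < _).
    by rewrite ler_pM2l// lerDl.
  by rewrite -ltr_pdivlMr// ltr_wpDl.
have h1 : 0 <= 1 + h by move: heps; rewrite ltr_norml => /andP[? _]; lra.
have -> : (u s + t * x s) ^+ 2 = u s ^+ 2 * (1 + h) ^+ 2 by rewrite hE; ring.
rewrite powRM ?sqr_ge0// -u2_pot -[(1 + h) ^+ 2]powR_mulrn// -powRrM.
apply: le_trans (_ : u s ^+ 2 * pot s *
   (1 + 2 * (sigma + 1) * h + (sigma + 1) * k * h ^+ 2) <= _); last first.
  by apply: ler_wpM2l; [rewrite mulr_ge0 ?sqr_ge0 ?pot_ge0|exact: H].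
rewrite le_eqVlt; apply/orP; left; apply/eqP.
rewrite (_ : x s = h * u s / t); last by rewrite -hE; field; rewrite gt_eqF.
by field; rewrite gt_eqF.
Qed.

(** The genuine second order term is kept on a finite set of sites only;
    at the others convexity gives the zeroth and first order terms. This
    avoids any uniform control of the Taylor remainder. *)
Lemma lplus_fin x (k : R) (F : {fset lattice d}) : 0 <= k -> k < 2 * sigma + 1 ->
  l2 x -> dot u x = 0 ->
  k * \sum_(n <- F) pot n * x n ^+ 2 <= dirichlet x + c * dot x x.
Proof.
move=> k0 kp lx ux; have lu := wave_l2; have lpu := l2_pot_mul lu.
have [del del0 H] := local_taylor x F kp.
have lpx := l2_pot_mul lx.
have spx : asum (fun n => pot n * x n ^+ 2).
  by under eq_fun do rewrite expr2 mulrA; exact: asum_mul.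
pose a n := if n \in F then pot n * x n ^+ 2 else 0.
have a0 n : 0 <= a n.
  by rewrite /a; case: ifP => // _; rewrite mulr_ge0 ?pot_ge0 ?sqr_ge0.
have sa : asum a.
  apply: asum_le spx _ => n; rewrite /a; case: ifP => // _.
  by rewrite normr0.
have FE : \sum_(n <- F) pot n * x n ^+ 2 = \sum_(n <- F) a n.
  by rewrite !big_seq; apply: eq_bigr => n nF; rewrite /a nF.
apply: le_trans (_ : k * rsum a <= _).
  by rewrite ler_wpM2l// FE fin_le_rsum.
have := @second_variation x (fun=> 0) (k * rsum a) del del0 lx (@l2_0 _ _) ux.
rewrite dot0l dirichlet0 !addr0; apply=> t td; have [t0 _] := andP td.
rewrite -(rsumZ _ sa) -(rsumZ _ (asumZ k sa)) -(rsumZ _ (asum_mul lpu lx)).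
have s1 := asum_mul lpu lu.
have s2 := asumZ (2 * (sigma + 1) * t) (asum_mul lpu lx).
have s3 := asumZ ((sigma + 1) * t ^+ 2) (asumZ k sa).
rewrite -rsumD// -rsumD//; last exact: asumD.
apply: le_rsum; first by apply: asumD => //; exact: asumD.
  apply: asum_powR => // [n|]; first by rewrite addr_ge0 ?sqr_ge0.
  apply: asumD; last exact/l2Z/l2_0.
  by apply: l2D => //; exact: l2Z.
move=> n; rewrite mulr0 expr0n/= addr0 /a; case: ifP => [nF|_].
  apply: le_trans (H t n td nF).
  by rewrite le_eqVlt; apply/orP; left; apply/eqP; ring.
have q1 : 1 < sigma + 1 by have := s0; lra.
apply: le_trans (powR_tangent q1 (sqr_ge0 (u n)) (sqr_ge0 (u n + t * x n))).
rewrite -u2_pot addrK pot_sqr mulr0 mulr0 addr0 -subr_ge0.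
have -> : u n ^+ 2 * pot n + (sigma + 1) * pot n *
    ((u n + t * x n) ^+ 2 - u n ^+ 2) -
    (pot n * u n * u n + 2 * (sigma + 1) * t * (pot n * u n * x n)) =
    (sigma + 1) * pot n * (t * x n) ^+ 2 by ring.
by rewrite mulr_ge0 ?sqr_ge0// mulr_ge0 ?pot_ge0// addr_ge0// ltW.
Qed.

Definition lplus_pot : lattice d -> R := fun n => (2 * sigma + 1) * pot n.

Lemma bounded_lplus_pot : bounded_seq lplus_pot.
Proof.
have [C pC] := bounded_pot; exists (`|2 * sigma + 1| * C) => n.
by rewrite normrM ler_wpM2l.
Qed.

(** Exhausts the lattice by finite sets and lets k tend to 2 sigma + 1 in
    [lplus_fin]. *)
Lemma lplus_ge0 x : l2 x -> dot u x = 0 -> 0 <= dot (lop c lplus_pot x) x.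
Proof.
move=> lx ux; rewrite (dot_lop bounded_lplus_pot lx) subr_ge0.
have p0 : 0 < 2 * sigma + 1 by have := s0; lra.
set C := dirichlet x + c * dot x x.
have spx0 n : 0 <= lplus_pot n * x n * x n.
  by rewrite -mulrA mulr_ge0 -?expr2 ?sqr_ge0// mulr_ge0 ?pot_ge0// ltW.
apply: (@fin_bound_asum _ _ _ C spx0 _).2 => F.
have -> : \sum_(n <- F) lplus_pot n * x n * x n =
    (2 * sigma + 1) * \sum_(n <- F) pot n * x n ^+ 2.
  by rewrite mulr_sumr; apply: eq_bigr => n _; rewrite /lplus_pot; ring.
set S := \sum_(n <- F) _.
have S0 : 0 <= S by apply: sumr_ge0 => n _; rewrite mulr_ge0 ?pot_ge0 ?sqr_ge0.
apply/ler_addgt0Pr => e e0.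
(* k is lowered by at most e / (S + 1), which costs at most e in the sum; the
   minimum keeps k nonnegative *)
have kS := @lplus_fin x ((2 * sigma + 1) - Num.min (2 * sigma + 1) (e / (S + 1))) F.
have m1 : 0 < Num.min (2 * sigma + 1) (e / (S + 1)).
  by rewrite lt_min p0 divr_gt0//; lra.
have m2 : Num.min (2 * sigma + 1) (e / (S + 1)) <= 2 * sigma + 1.
  by rewrite ge_min lexx.
have m3 : Num.min (2 * sigma + 1) (e / (S + 1)) * S <= e.
  apply: le_trans (_ : e / (S + 1) * S <= _).
    by rewrite ler_wpM2r// ge_min lexx orbT.
  by rewrite mulrAC ler_pdivrMr ?ler_pM2l//; lra.
have := kS ltac:(lra) ltac:(lra) lx ux.
rewrite -/S -/C mulrBl; lra.
Qed.

End SecondVariation.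

(** * Consequences for the linearized operators *)

Section RealSpectrum.
Variables (R : realType) (d : nat) (sigma lambda c : R) (u : lattice d -> R).
Implicit Types (x y z g k : lattice d -> R).
Hypotheses (s0 : 0 < sigma) (lam0 : 0 < lambda).
Hypothesis wave : normalized_wave sigma lambda c u.

Local Notation W := (pot sigma u).
Local Notation V := (lplus_pot sigma u).
Local Notation Lp := (lop c V).
Local Notation Lm := (lop c W).

Let lu : l2 u := wave_l2 wave.
Let bW : bounded_seq W := bounded_pot s0 wave.
Let bV : bounded_seq V := bounded_lplus_pot s0 wave.

Lemma lminus_wave : Lm u = fun=> 0.
Proof.
apply/funext => n; have /(congr1 (fun f => f n)) := stationary s0 wave.
rewrite /lop /lc; lra.
Qed.

(** L_+ u = - 2 sigma u^(2 sigma + 1) because L_- u = 0, and the sum of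
    u^(2 sigma + 2) is the Dirichlet energy plus c lambda. *)
Lemma lplus_wave_neg : dot (Lp u) u < 0.
Proof.
have lWu := l2_pot_mul s0 wave lu.
have c0 := c_gt0 wave.
have d0 := dirichlet_ge0 lu.
have e : dirichlet u = dot (fun n => W n * u n) u - c * lambda.
  by rewrite /dirichlet (stationary s0 wave) dot_lcl// (wave_mass wave); ring.
have -> : Lp u = lc (- (2 * sigma)) (fun n => W n * u n) 0 u.
  apply/funext => n; have /(congr1 (fun f => f n)) := lminus_wave.
  rewrite /lop /lc /lplus_pot; lra.
rewrite dot_lcl// mul0r addr0 mulNr oppr_lt0 !mulr_gt0//.
have := mulr_gt0 c0 lam0; lra.
Qed.

Lemma ker_lplus_orth k : l2 k -> Lp k = (fun=> 0) -> dot u k = 0.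
Proof.
move=> lk Lk; apply/eqP/negPn/negP => uk.
have lLu := l2_lop c bV lu; have lLk := l2_lop c bV lk.
set al := lambda / dot u k.
have lv : l2 (lc 1 u (- al) k) by exact: l2_lc.
have uv : dot u (lc 1 u (- al) k) = 0.
  by rewrite dot_lcr// (wave_mass wave) /al; field.
have := lplus_ge0 s0 lam0 wave lv uv.
rewrite lop_lc dot_lcl// !dot_lcr// (lop_sym c bV lu lk) Lk dot0r !dot0l.
have := lplus_wave_neg; lra.
Qed.

Lemma lplus_inv_le0 g : l2 g -> Lp g = u -> dot g u <= 0.
Proof.
move=> lg Lg; rewrite leNgt; apply/negP => gu.
have lLu := l2_lop c bV lu; have lLg := l2_lop c bV lg.
set al := lambda / dot g u.
have lv : l2 (lc 1 u (- al) g) by exact: l2_lc.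
have gu0 : dot g u != 0 by rewrite gt_eqF.
have uv : dot u (lc 1 u (- al) g) = 0.
  by rewrite dot_lcr// (wave_mass wave) (dotC u g) /al; field.
have := lplus_ge0 s0 lam0 wave lv uv.
rewrite lop_lc dot_lcl// !dot_lcr// (lop_sym c bV lu lg) Lg (wave_mass wave).
rewrite (dotC u g) => h.
have e : al * dot g u = lambda by rewrite /al divfK.
have al0 : 0 < al by rewrite divr_gt0.
have := lplus_wave_neg; have := mulr_gt0 al0 lam0; nra.
Qed.

Lemma lplus_solvable : exists g, [/\ l2 g, Lp g = u
  & forall k, l2 k -> Lp k = (fun=> 0) -> dot g k = 0].
Proof.
have c0 := c_gt0 wave.
have p0 : 0 < 2 * sigma + 1 by have := s0; lra.
pose X := c / 2 / (2 * sigma + 1).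
have X0 : 0 < X by rewrite !divr_gt0.
have [F FE] := asum_small (powR_gt0 sigma^-1 X0) (fun n => sqr_ge0 (u n)) lu.
apply: lop_solve => //; last exact: ker_lplus_orth.
apply: (@fredholm_lop _ _ _ c0 _ F) => // n /FE un.
have : W n <= X.
  have -> : X = (X `^ sigma^-1) `^ sigma.
    by rewrite -powRrM mulVf ?gt_eqF// powRr1// ltW.
  rewrite -(pot_sqr wave).
  by apply: ge0_ler_powR; rewrite ?nnegrE ?sqr_ge0 ?powR_ge0 ?(ltW s0).
by rewrite /lplus_pot mulrC /X ler_pdivlMr.
Qed.

(** A null vector of a nonnegative form lies in the kernel: the form at
    y - t L_- y is - 2 t |L_- y|^2 + O(t^2). *)
Lemma lminus_null y : l2 y -> dot (Lm y) y = 0 -> Lm y = fun=> 0.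
Proof.
move=> ly y0; have lw := l2_lop c bW ly; set w := Lm y in y0 lw *.
have lLw := l2_lop c bW lw.
apply: dot_eq0 => //; apply/eqP; rewrite eq_le dot_ge0 andbT.
suff : 0 <= - (2 * dot w w) by lra.
apply: (@ge0_quadratic_limit R _ (dot (Lm w) w) 0 1 ltr01) => t /andP[t0 _].
have lv : l2 (lc 1 y (- t) w) by exact: l2_lc.
have := lminus_ge0 s0 lam0 wave lv.
rewrite lop_lc -/w dot_lcl// !dot_lcr// y0 (lop_sym c bW lw ly) -/w => h.
rewrite -(pmulr_rge0 _ t0); move: h; lra.
Qed.

(** The eigenvalue problem for mu = al + i be, with v1 = x1 + i y1 and
    v2 = x2 + i y2, in real coordinates. *)
Lemma no_growing_mode (al be : R) x1 y1 x2 y2 : 0 < al ->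
  l2 x1 -> l2 y1 -> l2 x2 -> l2 y2 ->
  Lm x2 = lc (- al) x1 be y1 -> Lm y2 = lc (- al) y1 (- be) x1 ->
  Lp x1 = lc al x2 (- be) y2 -> Lp y1 = lc al y2 be x2 ->
  [/\ x1 = (fun=> 0), y1 = (fun=> 0), x2 = (fun=> 0) & y2 = (fun=> 0)].
Proof.
move=> al0 lx1 ly1 lx2 ly2 mx2 my2 px1 py1.
have rot (a b : R) : al * a = be * b -> al * b = - be * a -> a = 0 /\ b = 0.
  move=> e1 e2.
  have s : 0 < al ^+ 2 + be ^+ 2 by rewrite ltr_wpDr ?sqr_ge0 ?exprn_gt0.
  have ha : (al ^+ 2 + be ^+ 2) * a = 0.
    have : al * (al * a) = be * (al * b) by rewrite e1; ring.
    rewrite e2; lra.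
  have hb : (al ^+ 2 + be ^+ 2) * b = 0.
    have : al * (al * b) = - be * (al * a) by rewrite e2; ring.
    rewrite e1; lra.
  by split; apply: (mulfI (lt0r_neq0 s)); rewrite mulr0.
have rotf x y : (forall n, al * x n = be * y n) ->
    (forall n, al * y n = - be * x n) -> x = (fun=> 0) /\ y = (fun=> 0).
  by move=> e1 e2; split; apply/funext => n; have [] := rot _ _ (e1 n) (e2 n).
(* L_- u = 0 makes the range of L_- orthogonal to u *)
have [ux1 uy1] : dot x1 u = 0 /\ dot y1 u = 0.
  have h1 : dot (Lm x2) u = 0 by rewrite lop_sym// lminus_wave dot0r.
  have h2 : dot (Lm y2) u = 0 by rewrite lop_sym// lminus_wave dot0r.
  rewrite mx2 dot_lcl// in h1; rewrite my2 dot_lcl// in h2.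
  by apply: rot; lra.
have ax := lplus_ge0 s0 lam0 wave lx1 (etrans (dotC _ _) ux1).
have ay := lplus_ge0 s0 lam0 wave ly1 (etrans (dotC _ _) uy1).
have bx := lminus_ge0 s0 lam0 wave lx2.
have by' := lminus_ge0 s0 lam0 wave ly2.
(* symmetry of L_- and L_+, that is reality of the two quadratic forms, gives
   <y1, x2> = <x1, y2>; the forms then take opposite values *)
have cm := lop_sym c bW lx2 ly2; have cp := lop_sym c bV lx1 ly1.
rewrite mx2 my2 dot_lcl// dot_lcr// in cm.
rewrite px1 py1 dot_lcl// dot_lcr// in cp.
rewrite (dotC x2 x1) (dotC x2 y1) in cm; rewrite (dotC x2 y1) (dotC y2 y1) in cp.
have q0 : dot y1 x2 - dot x1 y2 = 0.
  by apply: (mulfI (lt0r_neq0 al0)); rewrite mulr0; lra.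
have bq0 : be * dot y1 x2 = be * dot x1 y2.
  by congr (_ * _); apply/eqP; rewrite -subr_eq0 q0.
have [bx0 by0] : dot (Lm x2) x2 = 0 /\ dot (Lm y2) y2 = 0.
  move: ax ay bx by'; rewrite px1 py1 mx2 my2 !dot_lcl//.
  rewrite (dotC x2 x1) (dotC y2 x1) (dotC y2 y1) (dotC x2 y1) => *.
  by split; lra.
have x10 := lminus_null lx2 bx0; have y10 := lminus_null ly2 by0.
rewrite mx2 in x10; rewrite my2 in y10.
have [ex1 ey1] : x1 = (fun=> 0) /\ y1 = (fun=> 0).
  apply: rotf => n.
    by have /(congr1 (fun f => f n)) := x10; rewrite /lc; lra.
  by have /(congr1 (fun f => f n)) := y10; rewrite /lc; lra.
rewrite ex1 lop0 in px1; rewrite ey1 lop0 in py1.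
have [ex2 ey2] : x2 = (fun=> 0) /\ y2 = (fun=> 0).
  apply: rotf => n.
    by have /(congr1 (fun f => f n)) := px1; rewrite /lc; lra.
  by have /(congr1 (fun f => f n)) := py1; rewrite /lc; lra.
by split.
Qed.

End RealSpectrum.

(** * Complex sequences and conclusion *)

Section ComplexBridge.
Variables (R : realType) (d : nat).
Implicit Types (x y : lattice d -> R).

Lemma disc_laplacian_cseq x y :
  disc_laplacian (cseq x y) = cseq (disc_laplacian x) (disc_laplacian y).
Proof.
have sumE I (s : seq I) (a b : I -> R) :
    \sum_(i <- s) (a i +i* b i) = (\sum_(i <- s) a i) +i* (\sum_(i <- s) b i).
  by elim: s => [|i s IH]; rewrite ?big_nil// !big_cons IH.
have mulnE (a b : R) n : (a +i* b) *+ n = (a *+ n) +i* (b *+ n).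
  by elim: n => [|n IH]; rewrite ?mulr0n// !mulrSr IH.
apply/funext => n; rewrite /cseq !disc_laplacianE mulnE.
pose a (z : lattice d -> R) k := z (n + delta_mx ord0 k) + z (n - delta_mx ord0 k).
rewrite [X in X - _ = _](_ : _ = \sum_(k < d) (a x k +i* a y k)); last first.
  exact: eq_bigr.
by rewrite sumE; simpc.
Qed.

Lemma lplus_cseq sigma c (u : lattice d -> R) x y :
  Lplus sigma c u (cseq x y) =
  cseq (lop c (lplus_pot sigma u) x) (lop c (lplus_pot sigma u) y).
Proof.
apply/funext => n; rewrite /Lplus disc_laplacian_cseq /cseq /lop /lplus_pot.
by simpc.
Qed.

Lemma lminus_cseq sigma c (u : lattice d -> R) x y :
  Lminus sigma c u (cseq x y) =
  cseq (lop c (pot sigma u) x) (lop c (pot sigma u) y).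
Proof.
apply/funext => n; rewrite /Lminus disc_laplacian_cseq /cseq /lop /pot.
by simpc.
Qed.

Lemma inner_cseq x y x' y' : l2 x -> l2 y -> l2 x' -> l2 y' ->
  inner (cseq x y) (cseq x' y') =
  (dot x x' + dot y y') +i* (dot y x' - dot x y').
Proof.
move=> lx ly lx' ly'; rewrite /inner /csum -rsumD -?rsumB; try exact: asum_mul.
congr (_ +i* _); congr rsum; apply/funext => n; rewrite /cseq; simpc => /=; ring.
Qed.

Lemma cseq_inj x y x' y' : cseq x y = cseq x' y' -> x = x' /\ y = y'.
Proof.
by move=> h; split; apply/funext => n; have /(congr1 (fun f => f n)) := h;
  rewrite /cseq => -[].
Qed.

Lemma cseq0 : cseq (fun _ : lattice d => 0 : R) (fun=> 0) = 0.
Proof. by []. Qed.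

Lemma ker_lplus_cseq sigma c (u : lattice d -> R) x y :
  ker_Lplus sigma c u (cseq x y) <->
  [/\ l2 x, l2 y, lop c (lplus_pot sigma u) x = (fun=> 0)
    & lop c (lplus_pot sigma u) y = (fun=> 0)].
Proof.
rewrite /ker_Lplus /= in_l2_cseq lplus_cseq -cseq0; split.
  by move=> [[lx ly] /cseq_inj[]].
by move=> [lx ly -> ->].
Qed.

Lemma lplus_inv_cseq sigma c (u : lattice d -> R) x y :
  is_Lplus_inv sigma c u (complexify u) (cseq x y) ->
  [/\ l2 x, l2 y, lop c (lplus_pot sigma u) x = u
    & lop c (lplus_pot sigma u) y = (fun=> 0)].
Proof.
move=> [[/in_l2_cseq[lx ly] _]]; rewrite lplus_cseq complexify_cseq.
by move=> /cseq_inj[].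
Qed.

End ComplexBridge.

Lemma wave_spectrally_stable (R : realType) (d : nat) (sigma lambda c : R)
    (u : lattice d -> R) : 0 < sigma -> 0 < lambda ->
  normalized_wave sigma lambda c u -> spectrally_stable sigma c u.
Proof.
move=> s0 lam0 wave [[al be]] [[v1 v2]] [/= al0].
rewrite [v1]cseqE [v2]cseqE.
set x1 := fun n => complex.Re (v1 n); set y1 := fun n => complex.Im (v1 n).
set x2 := fun n => complex.Re (v2 n); set y2 := fun n => complex.Im (v2 n).
move=> [/in_l2_cseq[lx1 ly1] /in_l2_cseq[lx2 ly2]] v0.
rewrite /linearized_op /= lminus_cseq lplus_cseq => -[eqm eqp]; apply: v0.
have mulE x y : (fun n => (al +i* be) * cseq x y n) =
    cseq (lc al x (- be) y) (lc al y be x).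
  by apply/funext => n; rewrite /cseq /lc; simpc; congr (_ +i* _); ring.
rewrite !mulE in eqm eqp.
have [px py] := cseq_inj eqp.
have [mx my] : lop c (pot sigma u) x2 = lc (- al) x1 be y1 /\
    lop c (pot sigma u) y2 = lc (- al) y1 (- be) x1.
  by split; apply/funext => n; have /(congr1 (fun f => f n)) := eqm;
    rewrite /cseq /lc => -[h1 h2]; lra.
have [-> -> -> ->] := no_growing_mode s0 lam0 wave al0 lx1 ly1 lx2 ly2 mx my px py.
by [].
Qed.

Theorem theorem2 (R : realType) (d : nat) (sigma lambda c : R)
    (u : 'rV[int]_d -> R) :
  (1 <= d)%N -> 0 < sigma -> sigma < 2 / d%:R -> 0 < lambda ->
  normalized_wave sigma lambda c u ->
  let uC := complexify u in
  (forall k, ker_Lplus sigma c u k -> inner uC k = 0) /\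
  (exists! g, is_Lplus_inv sigma c u uC g) /\
  (forall g, is_Lplus_inv sigma c u uC g ->
     inner g uC <= 0 /\
     (inner g uC <> 0 -> inner g uC < 0 /\ spectrally_stable sigma c u)).
Proof.
move=> _ s0 _ lam0 wave uC.
have lu := wave_l2 wave; have l20 := @l2_0 R d.
have bV := bounded_lplus_pot s0 wave.
split; [|split].
- move=> k; rewrite [k]cseqE => /ker_lplus_cseq[lx ly Lx Ly].
  rewrite /uC complexify_cseq inner_cseq// !dot0l.
  by rewrite !(ker_lplus_orth s0 lam0 wave)// addr0 subr0.
- have [g [lg Lg gK]] := lplus_solvable s0 lam0 wave.
  exists (cseq g (fun=> 0)); split.
    split; last by rewrite lplus_cseq Lg lop0 /uC complexify_cseq.
    split=> [|k]; first exact/in_l2_cseq.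
    rewrite [k]cseqE => /ker_lplus_cseq[lx ly Lx Ly].
    by rewrite inner_cseq// !dot0l !gK// addr0 subr0.
  move=> g'; rewrite [g']cseqE.
  set x := fun n => complex.Re (g' n); set y := fun n => complex.Im (g' n).
  move=> h; have [lx ly Lx Ly] := lplus_inv_cseq h.
  have lxg : l2 (lc 1 x (-1) g) by exact: l2_lc.
  have Lxg : lop c (lplus_pot sigma u) (lc 1 x (-1) g) = fun=> 0.
    by rewrite lop_lc Lx Lg; apply/funext => n; rewrite /lc; ring.
  have [[_ /(_ (cseq (lc 1 x (-1) g) y)) orth] _] := h.
  have : ker_Lplus sigma c u (cseq (lc 1 x (-1) g) y) by exact/ker_lplus_cseq.
  (* the difference of two solutions is in the kernel, and both are orthogonal
     to it *)
  move=> /orth; rewrite inner_cseq// => -[re _].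
  have gxg := gK _ lxg Lxg.
  have e : dot (lc 1 x (-1) g) (lc 1 x (-1) g) + dot y y = 0.
    by rewrite dot_lcl// gxg; move: re; lra.
  have := dot_ge0 (lc 1 x (-1) g); have := dot_ge0 y => y0 xg0.
  have -> : y = fun=> 0 by apply: dot_eq0 => //; lra.
  have xg : lc 1 x (-1) g = fun=> 0 by apply: dot_eq0 => //; lra.
  congr cseq; apply/funext => n; have /(congr1 (fun f => f n)) := xg.
  rewrite /lc; lra.
- move=> g; rewrite [g]cseqE => /lplus_inv_cseq[lx ly Lx Ly].
  rewrite /uC complexify_cseq inner_cseq// !dot0r addr0 subr0.
  have -> : dot (fun n => complex.Im (g n)) u = 0.
    by rewrite -Lx -(lop_sym c bV ly lx) Ly dot0l.
  have le0 := lplus_inv_le0 s0 lam0 wave lx Lx.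
  split; first by rewrite lecE /= eqxx.
  move=> ne0; split; last exact: wave_spectrally_stable wave.
  rewrite ltcE /= eqxx lt_neqAle le0 !andbT.
  by apply/eqP => e; apply: ne0; rewrite e.
Qed.
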